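(* Let $1\le k\le n-1$, let $\lambda,\mu,\nu$ be partitions inside the $k\times(n-k)$ rectangle, and denote by $C_{\lambda\mu}^\nu(k,q)$ the equivariant Gromov-Witten invariants of $\mathrm{Gr}(k;n)$. For each $j\in\{1,\ldots,k\}$, with $i_j=\mu_j+k+1-j$, $$C_{\lambda\mu}^\nu(k,q)=\sum_{r=1}^n\sum_\rho A_{i_j,r}(\lambda/\rho)\,C_{\rho,\psi_{i_j}.\mu}^{\psi_r.\nu}(k-1,-q),$$ where the sum runs over all $\rho=(\rho_1,\ldots,\rho_{k-1})$ such that $\lambda/\rho$ is a horizontal strip. Similarly, for each $i\in\{1,\ldots,n\}$ with $i\ne\mu_j+k+1-j$ for all $j=1,\ldots,k$, $$C_{\lambda\mu}^\nu(k,q)=\sum_{r=1}^n\sum_\rho(-1)^{|\lambda/\rho|}B_{ir}(\lambda/\rho)\,C_{\rho,\psi^*_i.\mu}^{\psi_r^*.\nu}(k+1,-q),$$ where the sum runs over all $\rho=(\rho_1,\ldots,\rho_k)$ such that $\lambda/\rho$ is a vertical strip.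
   Context: Fix $n\ge2$; $R=\mathbb{Z}[y_1,\ldots,y_n]$, $y_j:=0$ for $j>n$. $(x|y)^m=\prod_{i=1}^m(x-y_i)$; $s_\lambda(x_1,\ldots,x_m|y)=\det\big((x_j|y)^{\lambda_i+m-i}\big)_{1\le i,j\le m}/\prod_{i<j}(x_i-x_j)$; $h_r=s_{(r)}$. For $1\le m\le n$, $$qH_T^*(\mathrm{Gr}(m;n))=R[q^{\pm1}][x_1,\ldots,x_m]^{S_m}/\langle h_{n-m+1},\ldots,h_{n-1},h_n+(-1)^mq\rangle ,$$ with Schubert basis $\sigma_\nu$ = class of $s_\nu(x_1,\ldots,x_m|y)$, $\nu\subset m\times(n-m)$; for $m=0$ the ring is $R[q^{\pm1}]$ with basis $\sigma_\emptyset=1$. Structure constants: $\sigma_\lambda\star\sigma_\mu=\sum_\nu C_{\lambda\mu}^\nu(m,q)\sigma_\nu$ (dependence on $y$ suppressed); $C(m,-q)$ means $q$ replaced by $-q$. A constant $C_{\rho\mu}^{\nu}(m,q)$ with $\rho\not\subset m\times(n-m)$ is $0$. $\sigma_\nu$, $\nu\subset m\times(n-m)$, is identified with $v_{w_1}\wedge\cdots\wedge v_{w_m}\in\bigwedge^m(R[q^{\pm1}]^n)$, $w_j=\nu_{m+1-j}+j$, where $v_1,\ldots,v_n$ is the standard basis; $\psi_i^*=v_i\wedge\cdot$ and $\psi_i(v_{j_1}\wedge\cdots\wedge v_{j_m})=\sum_r(-1)^{r-1}\delta_{i,j_r}v_{j_1}\wedge\cdots\widehat{v_{j_r}}\cdots\wedge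 v_{j_m}$. Notation $\psi_i.\nu$, $\psi_i^*.\nu$: if $\psi_i(\sigma_\nu)=\varepsilon\,\sigma_\alpha$ (resp. $\psi_i^*(\sigma_\nu)=\varepsilon\,\sigma_\alpha$) with $\varepsilon\in\{\pm1\}$, then $\psi_i.\nu$ (resp. $\psi_i^*.\nu$) stands for the signed diagram $\varepsilon\alpha$, and it is $0$ if the image is $0$; the $C$'s are extended linearly in signed diagrams in each slot: $C^{\varepsilon\alpha}_{\rho,\varepsilon'\beta}=\varepsilon\varepsilon'C^\alpha_{\rho\beta}$, and $C=0$ if an entry is $0$. The commuting translations act $R[q^{\pm1}]$-linearly by $t_j.\psi_i^*=\psi_{i+1}^*+(y_i-y_j)\psi_i^*$ and $t_j^{-1}.\psi_i=\psi_{i-1}+(y_i-y_j)\psi_i$, $1\le i\le n$, with $\psi^*_{n+1}:=z\psi^*_1$, $\psi_0:=z\psi_n$ and $z=(-1)^{k-1}q$, where $k$ and $q$ are those of the left hand sides. The matrix elements $A,B\in R[q^{\pm1}]$ are defined by $$\Big(\prod_{\square\in\lambda/\rho}t_{k+c(\square)}\Big).\psi_i^*=\sum_{r=1}^nA_{ir}(\lambda/\rho)\psi_r^*,\qquad\Big(\prod_{\square\in\lambda/\rho}t^{-1}_{k+1+c(\square)}\Big).\psi_i=\sum_{r=1}^nB_{ir}(\lambda/\rho)\psi_r .$$ A horizontal (vertical) strip is a skew diagram with at most one box in each column (row), possibly empty; $c(\square)=$ column minus row. *)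

(* Defs.v *)
From HB Require Import structures.
From Stdlib Require Import ClassicalEpsilon.
From mathcomp Require Import all_boot all_order all_algebra.
From mathcomp Require Import mpoly.

Set Implicit Arguments.
Unset Strict Implicit.
Unset Printing Implicit Defensive.

Import GRing.Theory.
Local Open Scope ring_scope.

(* R[q, q^-1], as the subring of Frac(R[q]) formed by the p / q^N, p in R[q]. *)
Section Laurent.
Variable R : idomainType.
Notation K := {fraction {poly R}}.
Notation "p %:F" := (tofrac p : K).

Definition laurent_pred : pred K := fun x =>
  if excluded_middle_informative
       (exists p : {poly R}, exists N : nat, x = p%:F / 'X%:F ^+ N)
  then true else false.

Lemma laurent_predP (x : K) :
  reflect (exists p : {poly R}, exists N : nat, x = p%:F / 'X%:F ^+ N)
          (laurent_pred x).
Proof.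
rewrite /laurent_pred; case: excluded_middle_informative => h /=.
  exact: ReflectT.
exact: ReflectF.
Qed.

Lemma tofracX_neq0 (N : nat) : 'X%:F ^+ N != 0.
Proof. by rewrite expf_neq0 // tofrac_eq0 polyX_eq0. Qed.

Lemma laurent_subring_closed : subring_closed laurent_pred.
Proof.
split.
- by apply/laurent_predP; exists 1, 0%N; rewrite expr0 divr1 tofrac1.
- move=> x y /laurent_predP[p [N ->]] /laurent_predP[r [M ->]].
  apply/laurent_predP; exists (p * 'X ^+ M - r * 'X ^+ N), (N + M)%N.
  rewrite tofracB !tofracM !tofracXn -mulNr addf_div ?tofracX_neq0 //.
  by rewrite -exprD mulNr.
- move=> x y /laurent_predP[p [N ->]] /laurent_predP[r [M ->]].
  apply/laurent_predP; exists (p * r), (N + M)%N.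
  by rewrite tofracM mulf_div exprD.
Qed.

HB.instance Definition _ :=
  GRing.isSubringClosed.Build K laurent_pred laurent_subring_closed.

Record laurent := Laurent { laurent_val :> K; _ : laurent_pred laurent_val }.

HB.instance Definition _ := [isSub for laurent_val].
HB.instance Definition _ := [Choice of laurent by <:].
HB.instance Definition _ := [SubChoice_isSubComNzRing of laurent by <:].

Definition laurent_unit : pred laurent := fun x =>
  (val x != 0) && laurent_pred (val x)^-1.

Definition laurent_inv (x : laurent) : laurent :=
  if laurent_unit x then insubd x (val x)^-1 else x.

Lemma laurent_mulVx : {in laurent_unit, left_inverse 1 laurent_inv *%R}.
Proof.
move=> x ux; have {}ux : laurent_unit x by [].
rewrite /laurent_inv ux; case/andP: ux => x0 xV; apply: val_inj.
by rewrite rmorphM rmorph1 /= insubdK // mulVf.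
Qed.

Lemma laurent_unitP (x y : laurent) : y * x = 1 -> laurent_unit x.
Proof.
move=> /(congr1 val); rewrite rmorphM rmorph1 /= => yx.
have x0 : val x != 0.
  by apply/eqP => /= x0; have /eqP := yx; rewrite x0 mulr0 eq_sym oner_eq0.
rewrite /laurent_unit x0 -[_^-1]mul1r -yx mulfK //; exact: valP.
Qed.

Lemma laurent_inv_out : {in [predC laurent_unit], laurent_inv =1 id}.
Proof.
move=> x ux; have /negbTE nu : ~~ laurent_unit x by [].
by rewrite /laurent_inv nu.
Qed.

HB.instance Definition _ := GRing.ComNzRing_hasMulInverse.Build laurent
  laurent_mulVx laurent_unitP laurent_inv_out.

Lemma laurent_idomain (x y : laurent) : x * y = 0 -> (x == 0) || (y == 0).
Proof.
move=> /(congr1 val); rewrite rmorphM rmorph0 => /eqP.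
by rewrite mulf_eq0 -!(inj_eq val_inj) rmorph0.
Qed.

HB.instance Definition _ :=
  GRing.ComUnitRing_isIntegral.Build laurent laurent_idomain.

Lemma laurent_of_poly_subproof (p : {poly R}) : laurent_pred p%:F.
Proof. by apply/laurent_predP; exists p, 0%N; rewrite expr0 divr1. Qed.

Definition laurent_of_poly (p : {poly R}) : laurent :=
  Laurent (laurent_of_poly_subproof p).

Definition laurent_q : laurent := laurent_of_poly 'X.

(* The substitution q := -q on Frac(R[q]), then on Laurent polynomials. *)
Definition frac_negq (x : K) : K :=
  (\n_(repr x) \Po (- 'X))%:F / (\d_(repr x) \Po (- 'X))%:F.

Lemma comp_polyNX_neq0 (p : {poly R}) : p != 0 -> p \Po (- 'X) != 0.
Proof.
apply: contraNneq => p0; rewrite -[p]comp_polyXr -['X]opprK.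
have -> : - - 'X = (- 'X) \Po (- 'X) :> {poly R} by rewrite rmorphN /= comp_polyX.
by rewrite comp_polyA p0 comp_poly0.
Qed.

Lemma frac_numden (x : K) : x = (\n_(repr x))%:F / (\d_(repr x))%:F.
Proof.
rewrite -{1}[x]reprK; move: (repr x) => r.
have r0 := denom_ratioP r.
apply: (canRL (mulfK _)); first by rewrite tofrac_eq0.
unlock FracField.tofrac; rewrite -[LHS]FracField.pi_mul.
apply/eqmodP; rewrite /= FracField.equivfE /FracField.mulf.
by rewrite !numden_Ratio ?mulf_neq0 ?oner_eq0 // !mulr1 mulrC.
Qed.

Lemma frac_negqE (p d : {poly R}) : d != 0 ->
  frac_negq (p%:F / d%:F) = (p \Po (- 'X))%:F / (d \Po (- 'X))%:F.
Proof.
move=> d0; rewrite /frac_negq.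
have dx0 := denom_ratioP (repr (p%:F / d%:F : K)).
have := frac_numden (p%:F / d%:F).
move: (\n_(repr _)) (\d_(repr _)) dx0 => a b b0 /eqP.
rewrite eqr_div ?tofrac_eq0 // -!tofracM tofrac_eq => /eqP E.
apply/eqP; rewrite eqr_div ?tofrac_eq0 ?comp_polyNX_neq0 // -!tofracM tofrac_eq.
by rewrite -!rmorphM /= -E.
Qed.

Lemma laurent_negq_subproof (x : laurent) : laurent_pred (frac_negq (val x)).
Proof.
have /laurent_predP[p [N ->]] := valP x.
rewrite -tofracXn frac_negqE ?expf_neq0 ?polyX_eq0 //.
apply/laurent_predP; exists ((-1) ^+ N * (p \Po (- 'X))), N.
rewrite rmorphXn /= comp_polyX [(- 'X) ^+ N]exprNn !tofracM !tofracXn.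
by rewrite invfM mulrA -exprVn tofracN tofrac1 invrN1 [_ * _%:F]mulrC.
Qed.

Definition laurent_negq (x : laurent) : laurent :=
  Laurent (laurent_negq_subproof x).

End Laurent.

(* A partition is a weakly decreasing list of row lengths; trailing zeros are
   kept, so that the number of rows is part of the data. Rows and columns are
   numbered from 0. *)
Section Diagrams.
Local Open Scope nat_scope.

Definition part (s : seq nat) (i : nat) : nat := nth 0 s i.

Definition rect (m l : nat) : seq (seq nat) :=
  [seq s <- [seq [seq val i | i <- t] | t : m.-tuple 'I_l.+1] | sorted geq s].

Definition boxes (lam rho : seq nat) : seq (nat * nat) :=
  [seq (i, j) | i <- iota 0 (size lam),
                j <- iota (part rho i) (part lam i - part rho i)].

Definition contained (rho lam : seq nat) : bool :=
  all (fun i => part rho i <= part lam i) (iota 0 (size rho)).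

Definition hstrip (lam rho : seq nat) : bool :=
  contained rho lam && uniq [seq b.2 | b <- boxes lam rho].

Definition vstrip (lam rho : seq nat) : bool :=
  contained rho lam && uniq [seq b.1 | b <- boxes lam rho].

(* sigma_nu = v_(w_1) /\ ... /\ v_(w_m) with w_j = nu_(m+1-j) + j *)
Definition word (nu : seq nat) : seq nat :=
  [seq part nu (size nu - j) + j | j <- iota 1 (size nu)].

Definition diag (w : seq nat) : seq nat :=
  rev [seq nth 0 w j - j.+1 | j <- iota 0 (size w)].

Definition inversions (w : seq nat) : nat :=
  \sum_(j < size w) \sum_(i < size w | i < j) (nth 0 w j < nth 0 w i).
End Diagrams.

(* (e, a) stands for e * a with e in {-1, 0, 1}; the zero diagram has e = 0,
   its second component being irrelevant. *)
Definition sdiagram := (int * seq nat)%type.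

(* v_(w_1) /\ ... /\ v_(w_m) for an arbitrary word w *)
Definition wedge (w : seq nat) : sdiagram :=
  if uniq w then ((-1) ^+ inversions w, diag (sort leq w)) else (0, [::]).

Definition psi_star_diag (i : nat) (nu : seq nat) : sdiagram :=
  wedge (i :: word nu).

(* index i w = r - 1 when j_r = i is the r-th letter of w *)
Definition psi_diag (i : nat) (nu : seq nat) : sdiagram :=
  let w := word nu in
  if i \in w then ((-1) ^+ index i w, diag (rem i w)) else (0, [::]).

Section FactorialSchur.
Variables (L : idomainType) (y : nat -> L) (m : nat).

(* (x|y)^r *)
Definition fpower (x : {mpoly L[m]}) (r : nat) : {mpoly L[m]} :=
  \prod_(1 <= i < r.+1) (x - (y i)%:MP).

Definition alternant (lam : seq nat) : {mpoly L[m]} :=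
  \det (\matrix_(i < m, j < m) fpower 'X_j (part lam i + (m - i.+1))).

Definition vandermonde : {mpoly L[m]} :=
  \prod_(i < m) \prod_(j < m | (i < j)%N) ('X_i - 'X_j).

(* The exact quotient alternant / vandermonde in the domain L[x_1, ..., x_m]. *)
Definition fschur (lam : seq nat) : {mpoly L[m]} :=
  epsilon (inhabits 0) (fun s => s * vandermonde = alternant lam).
End FactorialSchur.

Section QuantumCohomology.
Variable n : nat.

Definition coefring := laurent {mpoly int[n]}.

(* y_j is the variable of index j - 1 if 1 <= j <= n, and 0 if j > n *)
Definition yvar (j : nat) : coefring :=
  laurent_of_poly (\sum_(i < n | i.+1 == j) 'X_i)%:P.

Definition qvar : coefring := laurent_q {mpoly int[n]}.

Section Grassmannian.
Variable m : nat.

Definition schubert (nu : seq nat) : {mpoly coefring[m]} := fschur yvar m nu.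

(* The m generators h_(n-m+1), ..., h_(n-1), h_n + (-1)^m q; none if m = 0. *)
Definition qH_relation (i : 'I_m) : {mpoly coefring[m]} :=
  schubert [:: (n - m + i.+1)%N]
    + (if i.+1 == m then ((-1) ^+ m * qvar)%:MP else 0).

(* Equality of classes modulo the ideal of the ring of symmetric polynomials. *)
Definition qH_eq (f g : {mpoly coefring[m]}) : Prop :=
  exists a : 'I_m -> {mpoly coefring[m]},
    (forall i, a i \is symmetric) /\ f - g = \sum_i a i * qH_relation i.

(* C lam mu nu = C_(lam, mu)^nu(m, q) *)
Definition structure_constants
    (C : seq nat -> seq nat -> seq nat -> coefring) : Prop :=
  (forall lam mu, lam \in rect m (n - m) -> mu \in rect m (n - m) ->
     qH_eq (schubert lam * schubert mu)
           (\sum_(nu <- rect m (n - m)) C lam mu nu *: schubert nu)) /\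
  (forall rho mu nu, rho \notin rect m (n - m) -> C rho mu nu = 0).
End Grassmannian.

(* C_(rho, b)^a for signed diagrams b, a *)
Definition signed_constant (C : seq nat -> seq nat -> seq nat -> coefring)
    (rho : seq nat) (b a : sdiagram) : coefring :=
  (a.1 * b.1)%:~R * C rho b.2 a.2.

(* The psi_i^* (resp. psi_i), 1 <= i <= n, are the standard basis of the row
   vectors, with psi_(n+1)^* = z psi_1^* and psi_0 = z psi_n; an operator is the
   matrix whose i-th row is the image of the i-th basis vector. *)
Section Translations.
Variable k : nat.

Definition basis (i : nat) : 'rV[coefring]_n := \row_(r < n) (r.+1 == i)%:R.

Definition zvar : coefring := (-1) ^+ k.-1 * qvar.

Definition psi_star (i : nat) : 'rV[coefring]_n :=
  if i == n.+1 then zvar *: basis 1 else basis i.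

Definition psi (i : nat) : 'rV[coefring]_n :=
  if i == 0%N then zvar *: basis n else basis i.

(* t_j on the psi_i^* and t_j^-1 on the psi_i *)
Definition trans (j : nat) : 'M[coefring]_n :=
  \matrix_(i < n)
    (psi_star i.+2 + (yvar i.+1 - yvar j) *: psi_star i.+1).

Definition trans_inv (j : nat) : 'M[coefring]_n :=
  \matrix_(i < n) (psi i + (yvar i.+1 - yvar j) *: psi i.+1).

(* For a box b of a diagram with at most k rows, k + b.2 - b.1 >= 1 is
   k + c(b). The factors commute, so their order is immaterial. *)
Definition Acoef (lam rho : seq nat) (i : nat) (r : 'I_n) : coefring :=
  (psi_star i *m
     \prod_(b <- boxes lam rho) trans (k + b.2 - b.1)) ord0 r.

Definition Bcoef (lam rho : seq nat) (i : nat) (r : 'I_n) : coefring :=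
  (psi i *m
     \prod_(b <- boxes lam rho) trans_inv (k.+1 + b.2 - b.1)) ord0 r.
End Translations.
End QuantumCohomology.

(* Main.v *)
From HB Require Import structures.
From Stdlib Require Import ClassicalEpsilon.
Require Import Defs.
From mathcomp Require Import all_boot all_order all_algebra all_fingroup.
From mathcomp Require Import mpoly ssrcomplements bigenough.
From mathcomp Require Import zify ring.

Set Implicit Arguments.
Unset Strict Implicit.
Unset Printing Implicit Defensive.

Import GRing.Theory BigEnough.
Local Open Scope ring_scope.

(** Write L for the coefficient ring and let V = L[x]/((x|y)^n - z), with the
    basis (x|y)^0, ..., (x|y)^(n-1), so that the m-th exterior power of V
    consists of the alternating polynomials in x_1, ..., x_m modulo the
    relations (x_j|y)^n = z. Multiplying by the Vandermonde determinant sends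
    the Schubert class of nu to the alternant of nu, which is the wedge of m
    basis vectors attached to nu. It also kills the relations of the quantum
    cohomology ring as soon as z = (-1)^(m-1) q: times the Vandermonde, the
    complete function h_(n-m+i) is a determinant whose first row is
    (x|y)^(n+i-1) = z times a monic polynomial of degree i - 1, and the other
    rows span all polynomials of degree at most m - 2. Hence C_(lam,mu)^nu is
    the coordinate on the wedge of nu of the polynomial s_lam times the
    alternant of mu [structure_constantsE].

    The value of z is the same for (m, q) and for (m - 1, -q) and (m + 1, -q),
    which explains the substitution q := -q: the three rings act on exterior
    powers of one and the same V.

    The first formula splits off one variable. Branching of factorial Schur
    polynomials [fschur_horizontal] gives
      s_lam(x_1..x_k) = sum_rho s_rho(x_1..x_(k-1)) prod (x_k - y_(k+c)),
    over horizontal strips lam/rho. Expanding the alternant of mu along the row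
    of the letter i, and letting s_lam act by symmetry as if the split variable
    were x_k, the factors x_k - y_(k+c) act on the basis vector
    (x_k|y)^(i-1) through the product of the translations t_(k+c), whose matrix
    elements are the A_ir [horizontal_recursion].

    The second formula adds one variable, by the inverse branching rule
    [fschur_vertical]
      s_lam(x_1..x_k) = sum_rho (-1)^|lam/rho| s_rho(x_1..x_(k+1))
                                 prod (x_(k+1) - y_(k+1+c)),
    over vertical strips. Up to sign, the wedge of mu is the contraction of the
    wedge of i and mu with the i-th coordinate of x_(k+1) [qpair_extend_slot],
    and the factors x_(k+1) - y_(k+1+c) act on that coordinate by transposed
    translations, whose matrix elements are the B_ir [vertical_recursion].

    Both branching rules come from row operations on determinants of factorial
    powers [det_fpow_horizontal, det_fpow_vertical]. The first one also shows
    that the Vandermonde divides the alternant of every partition. Coordinates on the tensor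
    powers of V are computed without forming quotient rings or tensor products,
    by the linear forms [pairing]. *)

(** * Evaluating polynomials through a matrix, one covector per variable *)

Section Pairing.
Variables (L : comNzRingType) (n : nat) (u : 'rV[L]_n) (M : 'M[L]_n).

(** The linear form which sends a monomial x^a to the product of the scalars
    u M^(a_j) v_j. When M is multiplication by x on a quotient of L[x] and u
    represents 1, this is the tensor product of the linear forms v_j on the
    quotient, composed with the projection from L[x_1, ..., x_m]. *)
Definition pairing m (v : 'I_m -> 'cV[L]_n) (f : {mpoly L[m]}) : L :=
  \sum_(a <- msupp f) f@_a * \prod_(j < m) (u *m M ^+ a j *m v j) ord0 ord0.

Section Fixed.
Variables (m : nat) (v : 'I_m -> 'cV[L]_n).

Lemma pairing_boundE (f : {mpoly L[m]}) d : (msize f <= d)%N ->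
  pairing v f =
    \sum_(a : 'X_{1..m < d})
       f@_a * \prod_(j < m) (u *m M ^+ (a : 'X_{1..m}) j *m v j) ord0 ord0.
Proof.
move=> le_fd; set I : subFinType _ := 'X_{1..m < d}.
rewrite /pairing (big_mksub I) ?msupp_uniq //=; first last.
  by move=> x /msize_mdeg_lt /leq_trans; apply.
by rewrite big_rmcond //= => j /memN_msupp_eq0 ->; rewrite mul0r.
Qed.

Lemma pairing_is_additive : additive (@pairing m v).
Proof.
move=> p q /=; pose_big_enough d.
  rewrite !(@pairing_boundE _ d) // -sumrB; apply/eq_bigr.
  by move=> a _; rewrite raddfB /= mulrBl.
by close.
Qed.

HB.instance Definition _ :=
  GRing.isAdditive.Build {mpoly L[m]} L (@pairing m v) pairing_is_additive.

Lemma pairingZ c f : pairing v (c *: f) = c * pairing v f.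
Proof.
pose_big_enough d.
  rewrite !(@pairing_boundE _ d) // mulr_sumr; apply/eq_bigr.
  by move=> a _; rewrite mcoeffZ mulrA.
by close.
Qed.

Lemma pairingX a : pairing v 'X_[a] =
  \prod_(j < m) (u *m M ^+ a j *m v j) ord0 ord0.
Proof. by rewrite /pairing msuppX big_seq1 mcoeffX eqxx mul1r. Qed.

End Fixed.

Lemma eq_pairing m (v w : 'I_m -> 'cV[L]_n) f : v =1 w ->
  pairing v f = pairing w f.
Proof.
move=> vw; apply: eq_bigr => a _; congr (_ * _).
by apply: eq_bigr => j _; rewrite vw.
Qed.

Lemma pairing_msym m (v : 'I_m -> 'cV[L]_n) (s : 'S_m) f :
  pairing v (msym s f) = pairing (v \o s) f.
Proof.
elim/mpolyind: f => [|c a f _ _ IH]; first by rewrite !raddf0.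
rewrite !raddfD /= IH msymZ !pairingZ msymX !pairingX; congr (_ * _ + _).
rewrite (reindex_inj (@perm_inj _ s)) /=; apply: eq_bigr => j _.
by rewrite mnmE permK.
Qed.

Lemma pairing_mwiden m (v : 'I_m.+1 -> 'cV[L]_n) f :
  pairing v (mwiden f) =
    pairing (fun j => v (widen_ord (leqnSn m) j)) f
    * (u *m v ord_max) ord0 ord0.
Proof.
elim/mpolyind: f => [|c a f _ _ IH]; first by rewrite !raddf0 mul0r.
rewrite !raddfD /= IH mulrDl mwidenZ !pairingZ mwidenX !pairingX -mulrA.
congr (_ * _ + _); rewrite big_ord_recr /= mnmwiden_ordmax expr0 mulmx1.
by congr (_ * _); apply: eq_bigr => j _; rewrite mnmwiden_widen.
Qed.

Lemma pairing_slot_sum m (v : 'I_m -> 'cV[L]_n) f j (I : finType) c w :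
  pairing [eta v with j |-> \sum_(i : I) c i *: w i] f =
    \sum_i c i * pairing [eta v with j |-> w i] f.
Proof.
elim/mpolyind: f => [|d a f _ _ IH].
  by rewrite raddf0 big1 // => i _; rewrite raddf0 mulr0.
rewrite raddfD /= IH pairingZ pairingX (bigD1 j) //= eqxx.
under [RHS]eq_bigr => i _.
  rewrite raddfD /= pairingZ pairingX (bigD1 j) //= eqxx.
  rewrite (_ : \prod_(k < m | k != j) _ = \prod_(k < m | k != j)
      (u *m M ^+ a k *m v k) ord0 ord0); last first.
    by apply: eq_bigr => k /negbTE ->.
  rewrite mulrDr; over.
rewrite big_split /=; congr (_ + _).
rewrite (eq_bigr (fun k => (u *m M ^+ a k *m v k) ord0 ord0)); last first.
  by move=> k /negbTE ->.
rewrite mulmx_sumr summxE mulr_suml mulr_sumr; apply: eq_bigr => i _.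
rewrite -scalemxAr mxE; ring.
Qed.

Lemma pairing_scale m (v : 'I_m -> 'cV[L]_n) f j c w :
  pairing [eta v with j |-> c *: w] f = c * pairing [eta v with j |-> w] f.
Proof.
have := pairing_slot_sum v f j (fun _ : 'I_1 => c) (fun _ => w).
by rewrite !big_ord1.
Qed.

Lemma pairing_mul_linear m (v : 'I_m -> 'cV[L]_n) f j c :
  pairing v (f * ('X_j - c%:MP)) =
    pairing [eta v with j |-> (M - c%:M) *m v j] f.
Proof.
elim/mpolyind: f => [|d a f _ _ IH]; first by rewrite mul0r !raddf0.
rewrite mulrDl !raddfD /= IH -scalerAl !pairingZ; congr (_ * _ + _).
rewrite mulrBr [_ * c%:MP]mulrC mul_mpolyC raddfB /= pairingZ.
rewrite -mpolyXD !pairingX (bigD1 j) //= [X in c * X](bigD1 j) //=.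
rewrite [RHS](bigD1 j) //= eqxx mnmDE mnm1E eqxx /=.
have eqP1 : \prod_(i < m | i != j) (u *m M ^+ (a + U_(j))%MM i *m v i) ord0 ord0
    = \prod_(i < m | i != j) (u *m M ^+ a i *m v i) ord0 ord0.
  apply: eq_bigr => i ij; rewrite mnmDE mnm1E eq_sym (negbTE ij) addn0 //.
have eqP2 : \prod_(i < m | i != j)
     (u *m M ^+ a i *m (if i == j then (M - c%:M) *m v j else v i)) ord0 ord0
    = \prod_(i < m | i != j) (u *m M ^+ a i *m v i) ord0 ord0.
  by apply: eq_bigr => i /negbTE ->.
rewrite eqP1 eqP2 mulrA -mulrBl; congr (_ * _).
rewrite addn1 exprSr -mulmxE mulmxBl mul_scalar_mx mulmxBr -scalemxAr !mulmxA.
by rewrite !mxE.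
Qed.

(** Multiplication by a polynomial in x_j acts on the j-th covector alone. *)
Lemma pairing_mul_prod m (v : 'I_m -> 'cV[L]_n) f j (I : Type) (s : seq I) c :
  pairing v (f * \prod_(b <- s) ('X_j - (c b)%:MP)) =
    pairing [eta v with j |-> (\prod_(b <- s) (M - (c b)%:M)) *m v j] f.
Proof.
elim: s f => [|b s IH] f.
  rewrite !big_nil mulr1; apply: eq_pairing => i /=.
  by case: eqP => // ->; rewrite mul1mx.
rewrite !big_cons mulrA IH pairing_mul_linear; apply: eq_pairing => i /=.
by rewrite eqxx -mulmxE -mulmxA; case: eqP.
Qed.

End Pairing.

(** * Partitions in a rectangle, horizontal and vertical strips *)

Section Partitions.
Local Open Scope nat_scope.

Lemma uniq_map_inj (T U : eqType) (f : T -> U) (s : seq T) :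
  uniq (map f s) -> {in s &, injective f}.
Proof.
elim: s => //= a s IH /andP[fa /IH inj] x z.
rewrite !inE => /predU1P[->|xs] /predU1P[->|zs] // e.
- by move: fa; rewrite e map_f.
- by move: fa; rewrite -e map_f.
- exact: inj.
Qed.

Lemma sorted_geqP (s : seq nat) :
  reflect (forall i, part s i.+1 <= part s i) (sorted geq s).
Proof.
apply: (iffP (sortedP 0)) => h i; last by move=> _; apply: h.
case: (ltnP i.+1 (size s)) => [/h //|le]; by rewrite {1}/part nth_default.
Qed.

(** Since [part] is zero beyond the last row, the three conditions may be
    required at all indices. *)
Lemma rectP (m l : nat) (s : seq nat) :
  reflect [/\ size s = m, forall i, part s i <= l
            & forall i, part s i.+1 <= part s i] (s \in rect m l).
Proof.
rewrite mem_filter; apply: (iffP andP).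
  case=> sS /mapP[t _ es]; move/sorted_geqP: sS; rewrite es => dec; split=> //.
  - by rewrite size_map size_tuple.
  - move=> i; case: (ltnP i (size (map val t))) => [lt|le]; last first.
      by rewrite /part nth_default.
    rewrite /part; have /mapP[x _ ->] := mem_nth 0 lt; exact: leq_ord.
case=> sz le dec; split; first exact/sorted_geqP.
apply/mapP; exists [tuple inord (part s i) | i < m]; first by rewrite mem_enum.
apply: (@eq_from_nth _ 0); first by rewrite size_map size_tuple sz.
move=> i lt; rewrite sz in lt; rewrite (nth_map ord0) ?size_tuple //.
have := tnth_mktuple (fun j : 'I_m => inord (part s j) : 'I_l.+1) (Ordinal lt).
by rewrite (tnth_nth ord0) /= => ->; rewrite inordK ?ltnS.
Qed.

Lemma rect_uniq m l : uniq (rect m l).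
Proof.
rewrite filter_uniq // map_inj_in_uniq ?enum_uniq // => s t _ _.
by move/(inj_map val_inj)/val_inj.
Qed.

Lemma rect_ext m l (s t : seq nat) : s \in rect m l -> t \in rect m l ->
  (forall i, i < m -> part s i = part t i) -> s = t.
Proof.
move=> /rectP[ss _ _] /rectP[st _ _] e.
by apply: (@eq_from_nth _ 0); rewrite ss ?st // => i /e.
Qed.

Lemma mkseq_rect m l (f : nat -> nat) :
  (forall i, i < m -> f i <= l) -> (forall i, i.+1 < m -> f i.+1 <= f i) ->
  mkseq f m \in rect m l.
Proof.
move=> fl dec; apply/rectP; rewrite size_mkseq; split=> // i; rewrite /part.
  case: (ltnP i m) => im; last by rewrite nth_default ?size_mkseq.
  by rewrite nth_mkseq ?fl.
case: (ltnP i.+1 m) => im; last by rewrite nth_default ?size_mkseq.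
by rewrite !nth_mkseq ?dec // ltnW.
Qed.

Lemma part_mkseq f m i : i < m -> part (mkseq f m) i = f i.
Proof. exact: nth_mkseq. Qed.

Lemma part_default s i : size s <= i -> part s i = 0.
Proof. exact: nth_default. Qed.

Lemma mem_boxes lam rho i j : ((i, j) \in boxes lam rho) =
  (i < size lam) && (part rho i <= j < part lam i).
Proof.
apply/allpairsPdep/idP.
  move=> [a [b [ha hb [-> ->]]]]; move: ha hb; rewrite !mem_iota /=; lia.
move=> h; exists i, j; split=> //; rewrite mem_iota; lia.
Qed.

Lemma boxes_uniq lam rho : uniq (boxes lam rho).
Proof.
apply: allpairs_uniq_dep => [|i _|]; try exact: iota_uniq.
by case=> [i j] [i' j'] _ _ /= [-> ->].
Qed.

Lemma part_decreasing (s : seq nat) i j : (forall i, part s i.+1 <= part s i) ->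
  i <= j -> part s j <= part s i.
Proof.
by move=> dec; elim: j => [|j IH]; rewrite leq_eqVlt => /predU1P[->|] // /IH;
  apply: leq_trans.
Qed.

(** Interlacing says that the column ranges of lam/rho in consecutive rows are
    disjoint, which for partitions is enough for all pairs of rows. *)
Lemma hstripP m l lam rho : lam \in rect m.+1 l -> rho \in rect m l ->
  reflect (forall i, i < m -> part lam i.+1 <= part rho i <= part lam i)
          (hstrip lam rho).
Proof.
move=> /rectP[sl _ dl] /rectP[sr _ dr]; apply: (iffP andP).
  case=> /allP /= cont uq i im.
  have le_i : part rho i <= part lam i.
    by apply: cont; rewrite mem_iota sr.
  rewrite le_i andbT; case: (leqP (part lam i.+1) (part rho i)) => [//|lt].
  have inj := uniq_map_inj uq.
  (* otherwise column rho_i meets both row i and row i.+1 *)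
  have e : (i, part rho i) = (i.+1, part rho i).
    apply: inj => //; rewrite mem_boxes sl; move: (dl i) (dr i); lia.
  by case: e; lia.
move=> inter; split.
  apply/allP => i; rewrite mem_iota sr /= => im.
  by have /andP[] := inter _ im.
rewrite map_inj_in_uniq ?boxes_uniq //.
suff disj i i' j : (i, j) \in boxes lam rho -> (i', j) \in boxes lam rho ->
    i < i' -> False.
  move=> [i j] [i' j'] /= bi bi' e; move: bi'; rewrite -e => bi'.
  by case: (ltngtP i i') => [/(disj _ _ _ bi bi')|/(disj _ _ _ bi' bi)|->].
rewrite !mem_boxes sl => bi bi' lt.
have im : i < m by lia.
by have := inter _ im; have := part_decreasing dl lt; lia.
Qed.

Lemma vstripP m l lam rho : lam \in rect m l -> rho \in rect m l ->
  reflect (forall i, i < m -> part rho i <= part lam i <= (part rho i).+1)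
          (vstrip lam rho).
Proof.
move=> /rectP[sl _ dl] /rectP[sr _ dr]; apply: (iffP andP).
  case=> /allP /= cont uq i im.
  have le_i : part rho i <= part lam i.
    by apply: cont; rewrite mem_iota sr.
  rewrite le_i /= leqNgt; apply/negP => lt.
  have inj := uniq_map_inj uq.
  have e : (i, part rho i) = (i, (part rho i).+1).
    by apply: inj => //; rewrite mem_boxes sl; lia.
  by case: e; lia.
move=> inter; split.
  apply/allP => i; rewrite mem_iota sr /= => im.
  by have /andP[] := inter _ im.
rewrite map_inj_in_uniq ?boxes_uniq // => -[i j] [i' j'] /=.
rewrite !mem_boxes sl => bi bi' e; move: bi'; rewrite -e => bi'.
have im : i < m by lia.
by have := inter _ im => ?; congr (_, _); lia.
Qed.

End Partitions.

(** * Determinants of factorial powers *)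

(** Used to turn the sums over functions which come out of determinants into
    sums over partitions, the other functions contributing zero. *)
Lemma sum_seq_inj (V : nmodType) (T : eqType) (I : finType) (s : seq T)
    (h : T -> I) (F : I -> V) :
  uniq s -> {in s &, injective h} ->
  (forall i, i \notin map h s -> F i = 0) ->
  \sum_(x <- s) F (h x) = \sum_i F i.
Proof.
move=> us inj F0; rewrite -(big_map h xpredT F) big_uniq ?map_inj_in_uniq //=.
by rewrite big_mkcond; apply: eq_bigr => i _; case: ifP => // /negbT /F0.
Qed.

Section Determinants.
Variable R : comNzRingType.

(** Multilinearity in all rows at once. *)
Lemma det_row_sum m (S : finType) (G : 'I_m -> S -> 'I_m -> R) :
  \det (\matrix_(i, j) \sum_s G i s j) =
    \sum_(f : {ffun 'I_m -> S}) \det (\matrix_(i, j) G i (f i) j).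
Proof.
rewrite /determinant exchange_big /=; apply: eq_bigr => s _.
rewrite -mulr_sumr; congr (_ * _).
under eq_bigr do rewrite mxE.
rewrite bigA_distr_bigA; apply: eq_bigr => f _.
by apply: eq_bigr => i _; rewrite mxE.
Qed.

Lemma det_row_scale m (c : 'I_m -> R) (G : 'I_m -> 'I_m -> R) :
  \det (\matrix_(i, j) (c i * G i j)) =
    (\prod_i c i) * \det (\matrix_(i, j) G i j).
Proof.
have -> : \matrix_(i, j) (c i * G i j) =
    diag_mx (\row_i c i) *m \matrix_(i, j) G i j.
  by apply/matrixP => i j; rewrite mul_diag_mx !mxE.
rewrite det_mulmx det_diag; congr (_ * _).
by apply: eq_bigr => i _; rewrite mxE.
Qed.

Lemma det_col_scale m (c : 'I_m -> R) (G : 'I_m -> 'I_m -> R) :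
  \det (\matrix_(i, j) (c j * G i j)) =
    (\prod_i c i) * \det (\matrix_(i, j) G i j).
Proof.
rewrite -det_tr -[in RHS]det_tr.
have tE (H : 'I_m -> 'I_m -> R) :
    (\matrix_(i, j) H i j)^T = \matrix_(i, j) H j i.
  by apply/matrixP => i j; rewrite !mxE.
by rewrite !tE -det_row_scale; congr (\det _); apply/matrixP => i j; rewrite !mxE.
Qed.

Lemma det_row_eq m (G : 'I_m -> 'I_m -> R) i1 i2 : i1 != i2 ->
  G i1 =1 G i2 -> \det (\matrix_(i, j) G i j) = 0.
Proof.
by move=> ne e; apply: (determinant_alternate ne) => j; rewrite !mxE e.
Qed.

Lemma det_last_col m (G : nat -> nat -> R) :
  (forall i, (i < m)%N -> G i m = 0) ->
  \det (\matrix_(i < m.+1, j < m.+1) G i j) =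
    G m m * \det (\matrix_(i < m, j < m) G i j).
Proof.
move=> z; rewrite (expand_det_col _ ord_max) big_ord_recr /= big1 ?add0r.
  rewrite mxE /cofactor addnn -signr_odd odd_double mul1r; congr (_ * \det _).
  by apply/matrixP => i j; rewrite !mxE !lift_max.
by move=> i _; rewrite mxE z ?mul0r //=.
Qed.

Lemma det_sub_next_rows m (w : nat -> R) (G : nat -> nat -> R) :
  \det (\matrix_(i < m.+1, j < m.+1) G i j) =
  \det (\matrix_(i < m.+1, j < m.+1)
      (G i j - (if (i < m)%N then w i * G i.+1 j else 0))).
Proof.
(* the row operation is left multiplication by a unitriangular matrix *)
pose U := \matrix_(i < m.+1, j < m.+1)
  ((i == j)%:R - (if i.+1 == j :> nat then w i else 0)) : 'M[R]_m.+1.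
have dU : \det U = 1.
  rewrite -det_tr det_trig.
    rewrite big1 // => i _; rewrite !mxE eqxx.
    by rewrite eqn_leq ltnn subr0.
  apply/is_trig_mxP => i j ij; rewrite !mxE -val_eqE /=.
  by rewrite !gtn_eqF ?subr0 // ltnS ltnW.
rewrite -[LHS]mul1r -dU -det_mulmx; congr (\det _).
apply/matrixP => i j; rewrite !mxE.
under eq_bigr => k do rewrite !mxE mulrBl.
rewrite sumrB; congr (_ - _).
  rewrite (bigD1 i) //= eqxx mul1r big1 ?addr0 // => k ki.
  by rewrite eq_sym (negbTE ki) mul0r.
case: ltnP => im.
  rewrite (bigD1 (Ordinal (im : (i.+1 < m.+1)%N))) //= eqxx big1 ?addr0 // => k.
  by rewrite -val_eqE /= eq_sym => /negbTE ->; rewrite mul0r.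
by rewrite big1 // => k _; rewrite gtn_eqF ?mul0r // ltnS (leq_trans _ im) // -ltnS.
Qed.

End Determinants.

Section FactorialPower.
Variables (R : comNzRingType) (y : nat -> R).
(** The factorial power (x|y)^r in an arbitrary commutative ring. *)
Definition fpow (x : R) (r : nat) : R := \prod_(1 <= i < r.+1) (x - y i).

Lemma fpow0 x : fpow x 0 = 1.
Proof. by rewrite /fpow big_geq. Qed.

Lemma fpowS x r : fpow x r.+1 = fpow x r * (x - y r.+1).
Proof. by rewrite /fpow big_nat_recr. Qed.

Lemma fpow_cat x a b : (a <= b)%N ->
  fpow x a * \prod_(a.+1 <= i < b.+1) (x - y i) = fpow x b.
Proof. by move=> ab; rewrite /fpow -big_cat_nat. Qed.

(** The summands telescope: those of index s and s + 1 differ by exchanging one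
    factor t - y_(s+1) for x - y_(s+1), which is a difference of x - t. *)
Lemma fpow_telescope x t a b : (a <= b)%N ->
  fpow x b - \prod_(a.+1 <= i < b.+1) (t - y i) * fpow x a =
  (x - t) * \sum_(a <= s < b) \prod_(s.+2 <= i < b.+1) (t - y i) * fpow x s.
Proof.
move=> ab.
pose D s := \prod_(s.+1 <= i < b.+1) (t - y i) * fpow x s.
have -> : fpow x b = D b by rewrite /D big_geq ?mul1r.
rewrite -/(D a) -(telescope_sumr D ab) mulr_sumr.
apply: eq_big_nat => s /andP[_ sb]; rewrite /D fpowS.
rewrite [\prod_(s.+1 <= i < b.+1) _]big_ltn //; ring.
Qed.

Lemma sum_nat_ord (V : nmodType) (F : nat -> V) a b N : (b <= N)%N ->
  \sum_(a <= s < b) F s = \sum_(s < N) (if (a <= s < b)%N then F s else 0).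
Proof.
move=> bN; rewrite (big_nat_widen _ _ _ _ _ bN) (big_nat_widenl _ 0) //=.
by rewrite big_mkcond big_mkord; apply: eq_bigr => s _; rewrite andbC.
Qed.

(** Let t = x_m be the last point. Subtracting from each row the next one, times
    the factor that makes them agree at t, leaves a single nonzero entry in the
    column of t. By [fpow_telescope] the other entries are x_j - t times a
    combination of the (x_j|y)^s with l_(i+1) <= s < l_i; these intervals are
    the interlacing conditions. *)
Lemma det_fpow_horizontal m (x : nat -> R) (l : nat -> nat) N :
  (forall i, l i.+1 <= l i)%N -> (l 0 <= N)%N ->
  \det (\matrix_(i < m.+1, j < m.+1) fpow (x j) (l i)) =
  (\prod_(j < m) (x j - x m)) *
  \sum_(f : {ffun 'I_m -> 'I_N})
     (fpow (x m) (l m) *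
      \prod_(i < m) (if (l i.+1 <= f i < l i)%N
                     then \prod_((f i).+2 <= k < (l i).+1) (x m - y k) else 0)) *
     \det (\matrix_(i < m, j < m) fpow (x j) (f i)).
Proof.
move=> dec lN; set t := x m.
have lN' i : (l i <= N)%N.
  by elim: i => // i IH; apply: leq_trans (dec i) IH.
pose w i := \prod_((l i.+1).+1 <= k < (l i).+1) (t - y k).
rewrite (det_sub_next_rows _ w (fun i j => fpow (x j) (l i))).
rewrite (det_last_col (G := fun i j => fpow (x j) (l i) -
  (if (i < m)%N then w i * fpow (x j) (l i.+1) else 0))); last first.
  by move=> i im; rewrite im mulrC fpow_cat ?subrr.
rewrite ltnn subr0 -/t.
pose G (i : 'I_m) (s : 'I_N) (j : 'I_m) :=
  (if (l i.+1 <= s < l i)%N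
   then \prod_(s.+2 <= k < (l i).+1) (t - y k) else 0) * fpow (x j) s.
have -> : \matrix_(i < m, j < m) (fpow (x j) (l i) -
      (if (i < m)%N then w i * fpow (x j) (l i.+1) else 0)) =
    \matrix_(i < m, j < m) ((x j - t) * \sum_s G i s j).
  apply/matrixP => i j; rewrite !mxE ltn_ord fpow_telescope //.
  rewrite (sum_nat_ord _ _ (lN' i)); congr (_ * _); apply: eq_bigr => s _.
  by rewrite /G; case: ifP => // _; rewrite mul0r.
rewrite (det_col_scale (fun j : 'I_m => x j - t) (fun i j => \sum_s G i s j)).
rewrite det_row_sum mulrCA mulr_sumr; congr (_ * _); apply: eq_bigr => f _.
by rewrite -mulrA -det_row_scale.
Qed.

(** The identity (x|y)^(l+1) - (t - y_(l+1)) (x|y)^l = (x - t) (x|y)^l, applied in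
    every row but the last, shows that the determinant of size m, multiplied by the
    x_j - t, is a determinant of size m + 1 with last row 1; expanding each row
    as a sum of two terms gives the right hand side. In the last row the choice
    [f ord_max = true] is given weight zero. *)
Lemma det_fpow_vertical m (x : nat -> R) (l : nat -> nat) :
  (\prod_(j < m) (x j - x m)) * \det (\matrix_(i < m, j < m) fpow (x j) (l i)) =
  \sum_(f : {ffun 'I_m.+1 -> bool})
    (\prod_(i < m.+1) (if (i < m)%N then
        (if f i then - (x m - y (l i).+1) else 1) else (~~ f i)%:R)) *
    \det (\matrix_(i < m.+1, j < m.+1)
       fpow (x j) (if (i < m)%N then ((l i).+1 - f i)%N else 0%N)).
Proof.
set t := x m.
pose G (i : 'I_m.+1) (b : bool) (j : 'I_m.+1) :=
  (if (i < m)%N then (if b then - (t - y (l i).+1) else 1) else (~~ b)%:R) *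
  fpow (x j) (if (i < m)%N then ((l i).+1 - b)%N else 0%N).
transitivity (\det (\matrix_(i < m.+1, j < m.+1) \sum_b G i b j)); last first.
  rewrite det_row_sum; apply: eq_bigr => f _.
  by rewrite -det_row_scale.
rewrite -(det_col_scale (fun j : 'I_m => x j - t) (fun i j => fpow (x j) (l i))).
have e i j : \sum_b G i b j =
    if (i < m)%N then (x j - t) * fpow (x j) (l i) else 1.
  rewrite big_bool /G /=; case: ltnP => im; last by rewrite fpow0 mul0r add0r mul1r.
  rewrite subn0 subn1 /= fpowS; ring.
have -> : \matrix_(i < m.+1, j < m.+1) \sum_b G i b j =
    \matrix_(i < m.+1, j < m.+1)
       (fun i j => if (i < m)%N then (x j - t) * fpow (x j) (l i) else 1) i j.
  by apply/matrixP => i j; rewrite !mxE e.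
rewrite (det_last_col (G := fun i j =>
  if (i < m)%N then (x j - t) * fpow (x j) (l i) else 1)); last first.
  by move=> i ->; rewrite subrr mul0r.
rewrite ltnn mul1r; congr (\det _); apply/matrixP => i j.
by rewrite !mxE ltn_ord.
Qed.

End FactorialPower.

(** * Branching rules for factorial Schur polynomials *)

Local Notation widen := (widen_ord (leqnSn _)).

Lemma big_boxes (R : comNzRingType) (lam rho : seq nat) (F : nat * nat -> R) :
  \prod_(b <- boxes lam rho) F b =
  \prod_(i < size lam) \prod_(part rho i <= j < part lam i) F (i : nat, j).
Proof.
rewrite /boxes big_allpairs_dep /=.
by rewrite -[iota 0 (size lam)](_ : index_iota 0 (size lam) = _) ?big_mkord //
           /index_iota subn0.
Qed.

Section FactorialSchur.
Variables (L : idomainType) (y : nat -> L).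

Local Notation Y := (fun i => (y i)%:MP).

(** The alternant with an arbitrary sequence of exponents in place of a
    strictly decreasing one. *)
Definition altdet m (l : nat -> nat) : {mpoly L[m]} :=
  \det (\matrix_(i < m, j < m) fpow (Y : nat -> {mpoly L[m]}) 'X_j (l i)).

Lemma alternantE m lam :
  alternant y m lam = altdet m (fun i => part lam i + (m - i.+1))%N.
Proof. by []. Qed.

Lemma eq_altdet m l l' : (forall i, (i < m)%N -> l i = l' i) ->
  altdet m l = altdet m l'.
Proof.
by move=> e; congr (\det _); apply/matrixP => i j; rewrite !mxE e.
Qed.

Lemma mwiden_fpow m (p : {mpoly L[m]}) r :
  mwiden (fpow Y p r) = fpow Y (mwiden p) r.
Proof.
rewrite rmorph_prod; apply: eq_bigr => i _.
by rewrite rmorphB /= mwidenC.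
Qed.

Lemma mwiden_U m (j : 'I_m) : mwiden 'X_j = 'X_(widen j) :> {mpoly L[m.+1]}.
Proof. by rewrite mwidenX mnmwiden1. Qed.

Lemma mwiden_altdet m l : mwiden (altdet m l) =
  \det (\matrix_(i < m, j < m) fpow Y ('X_(widen j) : {mpoly L[m.+1]}) (l i)).
Proof.
rewrite /altdet -det_map_mx; congr (\det _); apply/matrixP => i j.
by rewrite !mxE -mwiden_U -mwiden_fpow.
Qed.

Lemma mpolyX_inord m (j : 'I_m) : 'X_(inord j) = 'X_(widen j) :> {mpoly L[m.+1]}.
Proof. by congr 'X_(_); apply: val_inj; rewrite /= inordK // ltnW ?ltnS. Qed.

(** The ratio of the Vandermonde products in m + 1 and m variables. *)
Definition last_diffs m : {mpoly L[m.+1]} :=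
  \prod_(j < m) ('X_(widen j) - 'X_ord_max).

(** The box b contributes the index m + 1 + c(b). The same weight serves for
    horizontal strips, where m + 1 is the number of rows of lam, and for
    vertical strips, where m is. *)
Definition strip_weight m (lam rho : seq nat) : {mpoly L[m.+1]} :=
  \prod_(b <- boxes lam rho) ('X_ord_max - (y (m.+1 + b.2 - b.1))%:MP).

Lemma alternant_horizontal m l lam : lam \in rect m.+1 l ->
  alternant y m.+1 lam =
  last_diffs m * \sum_(rho <- rect m l | hstrip lam rho)
     strip_weight m lam rho * mwiden (alternant y m rho).
Proof.
move=> lamR; have /rectP[sl lel dl] := lamR.
pose e i := (part lam i + (m.+1 - i.+1))%N.
pose x j : {mpoly L[m.+1]} := 'X_(inord j).
have xm : x m = 'X_ord_max by congr 'X_(_); apply: val_inj; rewrite /= inordK.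
transitivity (\det (\matrix_(i < m.+1, j < m.+1) fpow Y (x j) (e i))).
  congr (\det _); apply/matrixP => i j; rewrite !mxE.
  by rewrite /x inord_val.
rewrite (@det_fpow_horizontal _ _ _ _ _ (l + m).+1); first last.
- by rewrite /e; move: (lel 0%N); lia.
- by move=> i; rewrite /e; move: (dl i); lia.
congr (_ * _).
  by apply: eq_bigr => j _; rewrite xm /x mpolyX_inord.
rewrite -[RHS]big_filter.
pose h (rho : seq nat) : {ffun 'I_m -> 'I_(l + m).+1} :=
  [ffun i : 'I_m => inord (part rho i + (m - i.+1))].
have hE rho (i : 'I_m) : rho \in rect m l ->
    h rho i = (part rho i + (m - i.+1))%N :> nat.
  by case/rectP => _ le _; rewrite ffunE inordK //; move: (le i); lia.
rewrite -(@sum_seq_inj _ _ _ [seq rho <- rect m l | hstrip lam rho] h).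
- apply: eq_big_seq => rho; rewrite mem_filter => /andP[hs rhoR].
  have /(hstripP lamR rhoR) inter := hs.
  rewrite alternantE mwiden_altdet; congr (_ * _); last first.
    by congr (\det _); apply/matrixP => i j; rewrite !mxE hE // /x mpolyX_inord.
  rewrite /strip_weight big_boxes sl big_ord_recr /= mulrC; congr (_ * _).
    apply: eq_bigr => i _; have im := ltn_ord i.
    have c : (e i.+1 <= h rho i < e i)%N.
      by rewrite hE // /e; move: (inter i im); lia.
    rewrite c hE // xm.
    have -> : (part rho i + (m - i.+1)).+2 = (part rho i + (m.+1 - i))%N by lia.
    have -> : (e i).+1 = (part lam i + (m.+1 - i))%N by rewrite /e; lia.
    rewrite big_addn addnK; apply: eq_bigr => j _; congr (_ - (y _)%:MP); lia.
  have /rectP[sr _ _] := rhoR.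
  rewrite (part_default (s := rho)) ?sr // /fpow /e xm subnn addn0.
  rewrite -[X in \prod_(X <= _ < _) _]add0n -[(part lam m).+1]addn1 big_addn addnK.
  by apply: eq_bigr => j _; congr (_ - (y _)%:MP); lia.
- by rewrite filter_uniq ?rect_uniq.
- move=> rho rho'; rewrite [rho \in _]mem_filter [rho' \in _]mem_filter.
  move=> /andP[_ r1] /andP[_ r2] eh.
  apply: (rect_ext r1 r2) => i im.
  have := congr1 (fun g : {ffun 'I_m -> 'I_(l + m).+1} => g (Ordinal im) : nat) eh.
  by rewrite !hE //= => /addIn.
move=> f; apply: contraNeq => nz.
(* a term which does not vanish interlaces lam, hence comes from a rho *)
have {nz} cond (i : 'I_m) : (e i.+1 <= f i < e i)%N.
  apply: contraNT nz => /negbTE c; rewrite (bigD1 i) //= c.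
  by rewrite mul0r mulr0 mul0r.
pose g i := if insub i is Some i' then (f i' - (m - i.+1))%N else 0%N.
have gE (i : 'I_m) : g i = (f i - (m - i.+1))%N by rewrite /g valK.
have gR : mkseq g m \in rect m l.
  apply: mkseq_rect => [i im|i im].
    rewrite (gE (Ordinal im)); move: (cond (Ordinal im)) (lel i); rewrite /e /=; lia.
  rewrite (gE (Ordinal im)) (gE (Ordinal (ltnW im))).
  move: (cond (Ordinal im)) (cond (Ordinal (ltnW im))); rewrite /e /=; lia.
apply/mapP; exists (mkseq g m).
  rewrite mem_filter gR andbT; apply/(hstripP lamR gR) => i im.
  rewrite part_mkseq // (gE (Ordinal im)).
  move: (cond (Ordinal im)); rewrite /e /=; lia.
apply/ffunP => i; apply: val_inj; rewrite /= hE // part_mkseq // gE.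
by move: (cond i); rewrite /e /=; lia.
Qed.

Lemma vandermondeS m : vandermonde L m.+1 = last_diffs m * mwiden (vandermonde L m).
Proof.
rewrite /vandermonde big_ord_recr /= [X in _ * X]big1 ?mulr1; last first.
  by move=> j; rewrite ltnNge -ltnS ltn_ord.
rewrite /last_diffs rmorph_prod -big_split; apply: eq_bigr => i _ /=.
rewrite big_mkcond big_ord_recr /= ltn_ord mulrC; congr (_ * _).
rewrite rmorph_prod [RHS]big_mkcond; apply: eq_bigr => j _ /=.
by case: ifP => // _; rewrite rmorphB /= !mwiden_U.
Qed.

Lemma vandermonde_neq0 m : vandermonde L m != 0.
Proof.
apply/prodf_neq0 => i _; apply/prodf_neq0 => j ij.
rewrite subr_eq0; apply: contraTneq ij => /(congr1 (mcoeff U_(i))).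
rewrite !mcoeffX eqxx => /eqP; case: (altP (j =P i)) => [->|ji]; first by rewrite ltnn.
by rewrite eq_mnm1 (negbTE ji) oner_eq0.
Qed.

Lemma fschurP m lam :
  (exists s, s * vandermonde L m = alternant y m lam) ->
  fschur y m lam * vandermonde L m = alternant y m lam.
Proof. exact: (epsilon_spec (inhabits 0)). Qed.

Lemma fschur_sumE m l lam : lam \in rect m.+1 l ->
  (forall rho, rho \in rect m l ->
     fschur y m rho * vandermonde L m = alternant y m rho) ->
  (\sum_(rho <- rect m l | hstrip lam rho)
      strip_weight m lam rho * mwiden (fschur y m rho)) * vandermonde L m.+1
  = alternant y m.+1 lam.
Proof.
move=> lamR IH; rewrite (alternant_horizontal lamR) vandermondeS mulrCA.
congr (_ * _); rewrite mulr_suml big_seq_cond [RHS]big_seq_cond.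
apply: eq_bigr => rho /andP[rhoR _].
by rewrite -mulrA -rmorphM /= IH.
Qed.

(** The quotient that defines [fschur] exists: the branching rule builds it from
    the quotients in one variable less. *)
Lemma fschur_rectE m l lam : lam \in rect m l ->
  fschur y m lam * vandermonde L m = alternant y m lam.
Proof.
elim: m lam => [|m IH] lam lamR; apply: fschurP.
  by exists 1; rewrite mul1r /vandermonde big_ord0 /alternant det_mx00.
by eexists; apply: (fschur_sumE lamR) => rho; apply: IH.
Qed.

Lemma vandermonde_cancel m (f g : {mpoly L[m]}) :
  f * vandermonde L m = g * vandermonde L m -> f = g.
Proof. by move/(mulIf (vandermonde_neq0 m)). Qed.

(** The part of the tableau formula that concerns the largest entry. *)
Lemma fschur_horizontal m l lam : lam \in rect m.+1 l ->
  fschur y m.+1 lam = \sum_(rho <- rect m l | hstrip lam rho)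
      strip_weight m lam rho * mwiden (fschur y m rho).
Proof.
move=> lamR; apply: vandermonde_cancel; rewrite (fschur_rectE lamR).
by rewrite (fschur_sumE lamR) // => rho; apply: fschur_rectE.
Qed.

Lemma fschurE m lam : (forall i, part lam i.+1 <= part lam i)%N ->
  fschur y m lam * vandermonde L m = alternant y m lam.
Proof.
move=> dec; pose lam' := mkseq (part lam) m.
have lamR : lam' \in rect m (part lam 0).
  by apply: mkseq_rect => i _ //; apply: part_decreasing.
apply: fschurP; exists (fschur y m lam').
rewrite (fschur_rectE lamR) !alternantE; apply: eq_altdet => i im.
by rewrite part_mkseq.
Qed.

(** The factorial powers of degrees 0, ..., m - 1 are monic, so their alternant
    is the Vandermonde; here this is the branching rule for empty diagrams. *)
Lemma alternant_nil m : alternant y m [::] = vandermonde L m.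
Proof.
elim: m => [|m IH]; first by rewrite /vandermonde big_ord0 /alternant det_mx00.
have nR k : nseq k 0%N \in rect k 0.
  by apply/rectP; rewrite size_nseq /part; split=> // i; rewrite !nth_nseq !if_same.
have nE k : alternant y k [::] = alternant y k (nseq k 0%N).
  by rewrite !alternantE; apply: eq_altdet => i ik; rewrite /part nth_nil nth_nseq ik.
rewrite nE (alternant_horizontal (nR _)) vandermondeS -IH nE; congr (_ * _).
have -> : rect m 0 = [:: nseq m 0%N].
  apply: perm_small_eq => //; apply: uniq_perm => //; first exact: rect_uniq.
  move=> s; rewrite inE; apply/idP/eqP => [/rectP[ss le _]|->//].
  apply: (@eq_from_nth _ 0%N) => [|i im]; rewrite ?size_nseq // nth_nseq -ss im.
  by move: (le i); rewrite leqn0 => /eqP.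
rewrite big_cons big_nil.
have -> : hstrip (nseq m.+1 0%N) (nseq m 0%N).
  by apply/(hstripP (nR _) (nR _)) => i im; rewrite /part !nth_nseq !if_same.
rewrite addr0 /strip_weight big_boxes big1 ?mul1r // => i _.
by rewrite /part !nth_nseq !if_same big_geq.
Qed.

Lemma msym_fpow m (s : 'S_m) (p : {mpoly L[m]}) r :
  msym s (fpow Y p r) = fpow Y (msym s p) r.
Proof.
rewrite rmorph_prod; apply: eq_bigr => i _.
by rewrite rmorphB /= /msym mmapC.
Qed.

Lemma msym_U m (s : 'S_m) (j : 'I_m) : msym s 'X_j = 'X_(s j) :> {mpoly L[m]}.
Proof. by rewrite /msym mmapX mmap1U. Qed.

Lemma msym_altdet m (s : 'S_m) l :
  msym s (altdet m l) = (-1) ^+ s * altdet m l.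
Proof.
rewrite /altdet -det_map_mx.
set A := (X in _ * \det X).
have -> : map_mx (msym s) A = col_perm s A.
  by apply/matrixP => i j; rewrite !mxE -msym_U -msym_fpow.
by rewrite col_permE det_mulmx det_perm odd_permV mulrC.
Qed.

Lemma msym_vandermonde m (s : 'S_m) :
  msym s (vandermonde L m) = (-1) ^+ s * vandermonde L m.
Proof. by rewrite -alternant_nil alternantE msym_altdet. Qed.

Lemma msym_fschur m (s : 'S_m) l lam : lam \in rect m l ->
  msym s (fschur y m lam) = fschur y m lam.
Proof.
move=> lamR; apply: vandermonde_cancel; rewrite (fschur_rectE lamR).
have /(congr1 (msym s)) := fschur_rectE lamR.
rewrite rmorphM /= msym_vandermonde alternantE msym_altdet mulrCA.
by move/(congr1 ( *%R ((-1) ^+ s))); rewrite !mulrA -expr2 sqrr_sign !mul1r.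
Qed.

Lemma signed_strip_weight m lam rho : (-1) ^+ size (boxes lam rho) * strip_weight m lam rho
  = \prod_(i < size lam) \prod_(part rho i <= j < part lam i)
       - ('X_ord_max - (y (m.+1 + j - i))%:MP).
Proof.
rewrite -(big_boxes _ _ (fun b => - ('X_ord_max - (y (m.+1 + b.2 - b.1))%:MP))).
rewrite /strip_weight; elim: (boxes lam rho) => [|b s IH]; first by rewrite !big_nil mul1r.
by rewrite !big_cons /= exprS -IH mulrACA mulN1r.
Qed.

(** A choice of boxes to remove, at most one per row, which does not leave a
    partition produces two equal exponents. This includes the removal of a box
    from an empty row: the exponent then collides with that of a later row, in
    the end with the exponent 0 of the additional last row. *)
Lemma alternant_vertical m l lam : lam \in rect m l ->
  last_diffs m * mwiden (alternant y m lam) =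
  \sum_(rho <- rect m l | vstrip lam rho)
    (-1) ^+ size (boxes lam rho) * strip_weight m lam rho *
    alternant y m.+1 (rcons rho 0%N).
Proof.
move=> lamR; have /rectP[sl lel dl] := lamR.
pose e i := (part lam i + (m - i.+1))%N.
pose x j : {mpoly L[m.+1]} := 'X_(inord j).
have xm : x m = 'X_ord_max by congr 'X_(_); apply: val_inj; rewrite /= inordK.
have partr rho : rho \in rect m l -> forall i, part (rcons rho 0%N) i = part rho i.
  case/rectP => sr _ _ i; rewrite /part nth_rcons sr.
  by case: (ltnP i m) => // im; rewrite if_same nth_default ?sr.
have part_m rho : rho \in rect m l -> part rho m = 0%N.
  by case/rectP => sr _ _; rewrite part_default ?sr.
rewrite alternantE mwiden_altdet.
transitivity ((\prod_(j < m) (x j - x m)) *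
    \det (\matrix_(i < m, j < m) fpow Y (x j) (e i))).
  congr (_ * _); last by congr (\det _); apply/matrixP => i j; rewrite !mxE /x mpolyX_inord.
  by apply: eq_bigr => j _; rewrite xm /x mpolyX_inord.
rewrite det_fpow_vertical -[RHS]big_filter.
pose h (rho : seq nat) : {ffun 'I_m.+1 -> bool} :=
  [ffun i : 'I_m.+1 => part rho i != part lam i].
rewrite -(@sum_seq_inj _ _ _ [seq rho <- rect m l | vstrip lam rho] h).
- apply: eq_big_seq => rho; rewrite mem_filter => /andP[vs rhoR].
  have /(vstripP lamR rhoR) inter := vs.
  congr (_ * _).
    rewrite signed_strip_weight sl big_ord_recr /= ltnn ffunE !part_m // eqxx mulr1.
    apply: eq_bigr => i _; rewrite ltn_ord ffunE /=.
    have := inter i (ltn_ord i); case: eqP => [->|ne] c; first by rewrite big_geq.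
    have -> : part lam i = (part rho i).+1 by lia.
    rewrite big_nat1 xm; congr (- (_ - (y _)%:MP)).
    by rewrite /e; have := ltn_ord i; lia.
  rewrite alternantE; congr (\det _); apply/matrixP => i j; rewrite !mxE /x inord_val.
  congr (fpow _ _ _); rewrite partr // ffunE.
  case: ltnP => im; first by have := inter i im; rewrite /e; lia.
  have -> : i = m :> nat by apply/eqP; rewrite eqn_leq im -ltnS ltn_ord.
  by rewrite part_m // subnn.
- by rewrite filter_uniq ?rect_uniq.
- move=> rho rho'; rewrite [rho \in _]mem_filter [rho' \in _]mem_filter.
  move=> /andP[v1 r1] /andP[v2 r2] eh.
  apply: (rect_ext r1 r2) => i im; have im' : (i < m.+1)%N by apply: ltnW.
  have /(vstripP lamR r1)/(_ i im) := v1; have /(vstripP lamR r2)/(_ i im) := v2.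
  have := congr1 (fun g : {ffun 'I_m.+1 -> bool} => g (Ordinal im')) eh.
  by rewrite !ffunE /=; case: eqP => a; case: eqP => b //=; lia.
move=> f; apply: contraNeq => nz.
pose g i := if insub i is Some i' then f i' else false.
have gE (i : 'I_m.+1) : g i = f i by rewrite /g valK.
(* E lists the exponents chosen by f; they are weakly decreasing, so when the
   determinant does not vanish they decrease strictly down to E m = 0 *)
pose E i := if (i < m)%N then ((e i).+1 - g i)%N else 0%N.
have fm : f ord_max = false.
  apply/negbTE; apply: contraNN nz => fm.
  by rewrite big_ord_recr /= ltnn fm /= mulr0 mul0r.
have Einj i i' : (i < i' <= m)%N -> E i <> E i'.
  move=> /andP[ii' i'm] eE; move/eqP: nz; apply.
  have im : (i < m.+1)%N by lia.
  have i'm' : (i' < m.+1)%N by lia.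
  rewrite (@det_row_eq _ _ _ (Ordinal im) (Ordinal i'm')) ?mulr0 //.
    by rewrite -val_eqE /= neq_ltn ii'.
  by move=> j; rewrite -!gE -/(E i) -/(E i') eE.
have Edec i : (i < m)%N -> (E i.+1 < E i)%N.
  move=> im; have := Einj i i.+1; rewrite ltnSn im => /(_ isT).
  by rewrite /E im /e; move: (dl i); case: (ltnP i.+1 m) => im'; case: (g i); lia.
have Ege d i : (i + d = m)%N -> (d <= E i)%N.
  elim: d i => // d IH i im; apply: leq_ltn_trans (Edec i _); last by lia.
  by apply: IH; lia.
have gle i : (i < m)%N -> (g i <= part lam i)%N.
  by move=> im; have := Ege _ i (subnKC (ltnW im)); rewrite /E im /e; lia.
have gR : mkseq (fun i => part lam i - g i)%N m \in rect m l.
  apply: mkseq_rect => i im; first by apply: leq_trans (leq_subr _ _) (lel i).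
  have := Edec i (ltnW im); rewrite /E im (ltnW im) /e.
  by have := gle _ im; have := gle _ (ltnW im); lia.
apply/mapP; exists (mkseq (fun i => part lam i - g i)%N m).
  rewrite mem_filter gR andbT; apply/(vstripP lamR gR) => i im.
  by rewrite part_mkseq //; have := gle i im; case: (g i); lia.
apply/ffunP => i; rewrite ffunE.
case: (ltnP i m) => im.
  by rewrite part_mkseq // gE; have := gle i im; rewrite gE; case: (f i); lia.
have -> : i = ord_max by apply: val_inj; apply/eqP; rewrite /= eqn_leq im -ltnS ltn_ord.
by rewrite fm /= !part_m.
Qed.

Lemma rect_rcons0 m l rho : rho \in rect m l -> rcons rho 0%N \in rect m.+1 l.
Proof.
case/rectP => sr le dec; apply/rectP; rewrite size_rcons sr; split=> // i.
  by rewrite /part nth_rcons; case: ltnP => // _; rewrite if_same.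
rewrite /part !nth_rcons; case: (ltnP i.+1) => im; last by rewrite if_same.
by rewrite (ltnW im); apply: dec.
Qed.

(** Inverse branching: fewer variables in terms of more variables. *)
Lemma fschur_vertical m l lam : lam \in rect m l ->
  mwiden (fschur y m lam) = \sum_(rho <- rect m l | vstrip lam rho)
    (-1) ^+ size (boxes lam rho) * strip_weight m lam rho *
    fschur y m.+1 (rcons rho 0%N).
Proof.
move=> lamR; apply: vandermonde_cancel; rewrite vandermondeS mulrCA -rmorphM /=.
rewrite (fschur_rectE lamR) (alternant_vertical lamR) mulr_suml.
rewrite big_seq_cond [RHS]big_seq_cond; apply: eq_bigr => rho /andP[rhoR _].
by rewrite -mulrA -(fschur_rectE (rect_rcons0 rhoR)) vandermondeS !mulrA.
Qed.

End FactorialSchur.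

(** * The substitution q := -q *)

Section NegQ.
Variable R : idomainType.
Local Notation "p %:F" := (tofrac p : {fraction {poly R}}).

Lemma frac_negq_mono (p : {poly R}) N :
  frac_negq (p%:F / 'X%:F ^+ N) = (p \Po - 'X)%:F / (- 'X)%:F ^+ N.
Proof.
rewrite -!tofracXn frac_negqE ?expf_neq0 ?polyX_eq0 //.
by rewrite rmorphXn /= comp_polyX.
Qed.

Lemma tofracNX_neq0 N : (- 'X)%:F ^+ N != 0.
Proof. by rewrite expf_neq0 // tofrac_eq0 oppr_eq0 polyX_eq0. Qed.

Lemma laurent_negq_is_additive : additive (@laurent_negq R).
Proof.
move=> x z; apply: val_inj; rewrite [RHS]rmorphB /= .
have /laurent_predP[p [N ep]] := valP x; have /laurent_predP[r [M er]] := valP z.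
change (frac_negq (val x - val z) = frac_negq (val x) - frac_negq (val z)).
have divB (K : fieldType) (a b c d : K) : b != 0 -> d != 0 ->
    a / b - c / d = (a * d - c * b) / (b * d).
  by move=> b0 d0; rewrite -mulNr addf_div // mulNr.
rewrite ep er divB ?tofracX_neq0 // -exprD.
rewrite -!tofracXn -!tofracM -tofracB tofracXn !tofracXn !frac_negq_mono.
rewrite divB ?tofracNX_neq0 // -exprD.
by rewrite rmorphB !rmorphM /= !rmorphXn /= !comp_polyX tofracB !tofracM !tofracXn.
Qed.

Lemma laurent_negq_is_monoid_morphism : monoid_morphism (@laurent_negq R).
Proof.
split.
  apply: val_inj; change (frac_negq (1 : {fraction {poly R}}) = 1).
  rewrite -{1}tofrac1 -[1%:F]divr1 -[X in _ / X](expr0 'X%:F).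
  by rewrite frac_negq_mono expr0 divr1 rmorph1 tofrac1.
move=> x z; apply: val_inj; rewrite [RHS]rmorphM /=.
have /laurent_predP[p [N ep]] := valP x; have /laurent_predP[r [M er]] := valP z.
change (frac_negq (val x * val z) = frac_negq (val x) * frac_negq (val z)).
rewrite ep er mulf_div -exprD -tofracM !frac_negq_mono mulf_div -exprD.
by rewrite rmorphM /= tofracM.
Qed.

HB.instance Definition _ :=
  GRing.isAdditive.Build (laurent R) (laurent R) (@laurent_negq R)
    laurent_negq_is_additive.
HB.instance Definition _ :=
  GRing.isMonoidMorphism.Build (laurent R) (laurent R) (@laurent_negq R)
    laurent_negq_is_monoid_morphism.

Lemma laurent_negq_poly (p : {poly R}) :
  laurent_negq (laurent_of_poly p) = laurent_of_poly (p \Po - 'X).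
Proof.
apply: val_inj => /=; have -> : p%:F = p%:F / 'X%:F ^+ 0 by rewrite expr0 divr1.
by rewrite frac_negq_mono expr0 divr1.
Qed.

Lemma laurent_negq_q : laurent_negq (laurent_q R) = - laurent_q R.
Proof.
rewrite laurent_negq_poly comp_polyX; apply: val_inj.
by rewrite rmorphN /= tofracN.
Qed.

Lemma laurent_negqC (c : R) :
  laurent_negq (laurent_of_poly c%:P) = laurent_of_poly c%:P.
Proof. by rewrite laurent_negq_poly comp_polyC. Qed.

End NegQ.

(** * The module L[x]/((x|y)^n - z) and its tensor powers *)

(** A monic polynomial of degree d is a combination of factorial powers of degree
    at most d, with leading coefficient 1. *)
Lemma prod_lin_expand (R : comNzRingType) (y w : nat -> R) n d :
  exists c : nat -> R, [/\ c d = 1, (forall s, (d < s)%N -> c s = 0) &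
    forall x, \prod_(n.+1 <= i < (n + d).+1) (x - w i) =
      \sum_(s < d.+1) c s * fpow y x s].
Proof.
elim: d => [|d [c [cd c0 cE]]].
  exists (fun s => (s == 0%N)%:R); split=> // [[]|x] //.
  by rewrite addn0 big_geq // big_ord1 fpow0 mulr1.
exists (fun s => (if s is s'.+1 then c s' else 0) + (y s.+1 - w (n + d).+1) * c s).
split=> [|[|s] ds|x].
- by rewrite cd c0 // mulr0 addr0.
- by [].
- by rewrite !c0 ?mulr0 ?addr0 // ltnW.
rewrite addnS big_nat_recr /=; last by rewrite ltnS leq_addr.
rewrite cE; under [RHS]eq_bigr do rewrite mulrDl.
rewrite big_split /= [in RHS]big_ord_recl /= mul0r add0r [X in _ = _ + X]big_ord_recr /=.
rewrite (c0 d.+1) // mulr0 mul0r addr0 -big_split mulr_suml.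
by apply: eq_bigr => s _ /=; rewrite fpowS; ring.
Qed.

Section Companion.
Variables (L : idomainType) (n : nat) (y : nat -> L) (z : L).
Local Notation Y := (fun i => (y i)%:MP).

Definition erow (i : nat) : 'rV[L]_n := \row_(r < n) (r.+1 == i)%:R.

Lemma erow_mul (i : 'I_n) p (A : 'M[L]_(n, p)) : erow i.+1 *m A = row i A.
Proof.
rewrite rowE; congr (_ *m _); apply/rowP => j.
by rewrite !mxE eqxx eqSS.
Qed.

(** Multiplication by x on L[x]/((x|y)^n - z) in the basis (x|y)^0, ...,
    (x|y)^(n-1), acting on row vectors; [erow i.+1] stands for (x|y)^i. *)
Definition companion : 'M[L]_n := \matrix_(i < n)
  ((if i.+1 == n then z *: erow 1 else erow i.+2) + y i.+1 *: erow i.+1).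

Definition mxfpow (e : nat) : 'M[L]_n :=
  \prod_(1 <= i < e.+1) (companion - (y i)%:M).

Lemma erow_companion i : (i < n)%N -> erow i.+1 *m (companion - (y i.+1)%:M) =
  if i.+1 == n then z *: erow 1 else erow i.+2.
Proof.
move=> im; rewrite mulmxBr mul_mx_scalar.
by rewrite (erow_mul (Ordinal im)) rowK /= addrK.
Qed.

Lemma mxfpowS e : mxfpow e.+1 = mxfpow e *m (companion - (y e.+1)%:M).
Proof. by rewrite /mxfpow big_nat_recr. Qed.

Lemma erow_mxfpow e : (e < n)%N -> erow 1 *m mxfpow e = erow e.+1.
Proof.
elim: e => [|e IH] en; first by rewrite /mxfpow big_geq // mulmx1.
rewrite mxfpowS mulmxA IH; last exact: ltnW.
by rewrite erow_companion ?ltn_eqF // ltnW.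
Qed.

Lemma comm_companion (a b : L) :
  GRing.comm (companion - a%:M) (companion - b%:M).
Proof.
by apply: commrB; last exact: scalar_mxC; apply: commr_sym; apply: commrB => //;
  exact: scalar_mxC.
Qed.

Lemma comm_mxfpow a e : GRing.comm (mxfpow a) (mxfpow e).
Proof.
by apply: commr_prod => i _; apply: commr_sym; apply: commr_prod => j _; apply: comm_companion.
Qed.

(** The defining relation (x|y)^n = z. It holds on the cyclic vector 1, hence
    everywhere since the factorial powers of the matrix commute. *)
Lemma mxfpow_n : (0 < n)%N -> mxfpow n = z%:M.
Proof.
move=> n0; apply/row_matrixP => r; rewrite -!erow_mul mul_mx_scalar.
have [rn nn] : (r < n)%N /\ (n.-1 < n)%N by rewrite ltn_ord prednK.
rewrite -{1}(erow_mxfpow rn) -mulmxA.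
have -> : mxfpow r *m mxfpow n = mxfpow n *m mxfpow r by exact: comm_mxfpow.
have -> : mxfpow n = mxfpow n.-1 *m (companion - (y n.-1.+1)%:M).
  by rewrite -mxfpowS prednK.
rewrite !mulmxA erow_mxfpow // erow_companion //.
by rewrite prednK // eqxx -scalemxAl erow_mxfpow.
Qed.

Lemma mxfpow_cat e : (0 < n)%N ->
  mxfpow (n + e) = z *: \prod_(n.+1 <= i < (n + e).+1) (companion - (y i)%:M).
Proof.
move=> n0; rewrite /mxfpow (@big_cat_nat _ _ _ n.+1) //=; last by rewrite ltnS leq_addr.
by rewrite -/(mxfpow n) mxfpow_n // -mulmxE mul_scalar_mx.
Qed.

(** The coordinate form of (x|y)^d. *)
Definition ecol (d : nat) : 'cV[L]_n := (erow d.+1)^T.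

Lemma erow_ecol e d : (e < n)%N -> (erow e.+1 *m ecol d) ord0 ord0 = (e == d)%:R.
Proof. by move=> en; rewrite (erow_mul (Ordinal en)) !mxE eqSS. Qed.

(** The value of the form v_1 (x) ... (x) v_m on the class of f in the m-th tensor
    power of L[x]/((x|y)^n - z). *)
Definition qpair m (v : 'I_m -> 'cV[L]_n) (f : {mpoly L[m]}) : L :=
  pairing (erow 1) companion v f.

Lemma eq_qpair m (v w : 'I_m -> 'cV[L]_n) f : v =1 w -> qpair v f = qpair w f.
Proof. exact: eq_pairing. Qed.

Lemma qpair_sum m (v : 'I_m -> 'cV[L]_n) (I : Type) (r : seq I) (P : pred I)
    (F : I -> {mpoly L[m]}) :
  qpair v (\sum_(i <- r | P i) F i) = \sum_(i <- r | P i) qpair v (F i).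
Proof. exact: raddf_sum. Qed.

Lemma qpairD m (v : 'I_m -> 'cV[L]_n) f g : qpair v (f + g) = qpair v f + qpair v g.
Proof. exact: raddfD. Qed.

Lemma qpair0 m (v : 'I_m -> 'cV[L]_n) : qpair v 0 = 0.
Proof. exact: raddf0. Qed.

Lemma qpairZ m (v : 'I_m -> 'cV[L]_n) c f : qpair v (c *: f) = c * qpair v f.
Proof. exact: pairingZ. Qed.

Lemma qpairC m (v : 'I_m -> 'cV[L]_n) c f : qpair v (c%:MP * f) = c * qpair v f.
Proof. by rewrite mul_mpolyC /qpair pairingZ. Qed.

Lemma qpair_fpow m (v : 'I_m -> 'cV[L]_n) f j e :
  qpair v (f * fpow Y 'X_j e) = qpair [eta v with j |-> mxfpow e *m v j] f.
Proof. exact: (pairing_mul_prod _ _ v f j (index_iota 1 e.+1) y). Qed.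

Lemma qpair_fpow_prod m (v : 'I_m -> 'cV[L]_n) f (e : 'I_m -> nat) :
  qpair v (f * \prod_j fpow Y 'X_j (e j)) = qpair (fun j => mxfpow (e j) *m v j) f.
Proof.
suff gen (s : seq 'I_m) : uniq s -> forall w, qpair w (f * \prod_(j <- s) fpow Y 'X_j (e j)) =
    qpair (fun j => if j \in s then mxfpow (e j) *m w j else w j) f.
  rewrite gen ?index_enum_uniq //; apply: eq_pairing => j.
  by rewrite mem_index_enum.
elim: s => [_|a s IH /= /andP[as_ us]] w.
  by rewrite big_nil mulr1.
rewrite big_cons mulrA mulrAC qpair_fpow IH //; apply: eq_pairing => j /=.
rewrite inE; case: eqP => [->|_] //=; by rewrite (negbTE as_).
Qed.

Lemma qpair1 m (v : 'I_m -> 'cV[L]_n) :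
  qpair v 1 = \prod_j (erow 1 *m v j) ord0 ord0.
Proof.
rewrite /qpair -mpolyX0 pairingX; apply: eq_bigr => j _.
by rewrite mnm0E expr0 mulmx1.
Qed.

Lemma qpair_altdet m (v : 'I_m -> 'cV[L]_n) (e : nat -> nat) :
  qpair v (altdet y m e) =
  \det (\matrix_(i < m, j < m) (erow 1 *m (mxfpow (e i) *m v j)) ord0 ord0).
Proof.
rewrite /altdet /determinant qpair_sum; apply: eq_bigr => s _ /=.
have -> : (-1) ^+ s = ((-1) ^+ s : L)%:MP :> {mpoly L[m]}.
  by rewrite rmorphXn rmorphN1.
rewrite qpairC; congr (_ * _).
rewrite (reindex_inj (@perm_inj _ (s^-1)%g)) /=.
under eq_bigr => j _ do rewrite mxE permKV.
rewrite -[X in qpair _ X]mul1r.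
rewrite (qpair_fpow_prod v 1 (fun j => e ((s^-1)%g j))) qpair1.
rewrite [RHS](reindex_inj (@perm_inj _ (s^-1)%g)) /=.
by apply: eq_bigr => j _; rewrite mxE permKV.
Qed.

Lemma qpair_altdet_ecol m (d e : nat -> nat) :
  (forall i, (i < m)%N -> (e i < n)%N) ->
  qpair (fun j : 'I_m => ecol (d j)) (altdet y m e) =
  \det (\matrix_(i < m, j < m) (e i == d j)%:R).
Proof.
move=> en; rewrite qpair_altdet; congr (\det _); apply/matrixP => i j.
by rewrite [LHS]mxE [RHS]mxE mulmxA erow_mxfpow ?erow_ecol ?en.
Qed.

(** Replacing the first row allows exponents beyond n to be rewritten by the
    relation (x|y)^n = z, after which the row is no longer a factorial power. *)
Definition altdet_row0 m (P : {mpoly L[m.+1]} -> {mpoly L[m.+1]}) (e : nat -> nat) :=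
  \det (\matrix_(i < m.+1, j < m.+1)
     if i == ord0 then P 'X_j else fpow Y 'X_j (e i)).

Lemma altdet_row0E m e e' : (forall i, (0 < i <= m)%N -> e i = e' i) ->
  altdet_row0 (fun x : {mpoly L[m.+1]} => fpow Y x (e 0%N)) e' = altdet y m.+1 e.
Proof.
move=> ee; congr (\det _); apply/matrixP => i j; rewrite !mxE.
case: eqP => [->|/eqP] //; rewrite -val_eqE /= => i0.
by rewrite ee // lt0n i0 -ltnS ltn_ord.
Qed.

Lemma altdet_row0_expand m P e : altdet_row0 P e = \sum_(j < m.+1) P 'X_j *
  cofactor (\matrix_(i < m.+1, j < m.+1) fpow Y 'X_j (e i)) ord0 j.
Proof.
rewrite /altdet_row0 (expand_det_row _ ord0); apply: eq_bigr => j _.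
rewrite mxE eqxx; congr (_ * (_ * \det _)); apply/matrixP => a b.
by rewrite !mxE.
Qed.

Lemma altdet_row0_sum m (I : Type) (r : seq I) (c : I -> {mpoly L[m.+1]}) P e :
  altdet_row0 (fun x => \sum_(s <- r) c s * P s x) e =
  \sum_(s <- r) c s * altdet_row0 (P s) e.
Proof.
rewrite altdet_row0_expand; under eq_bigr do rewrite mulr_suml.
rewrite exchange_big /=; apply: eq_bigr => s _.
by rewrite altdet_row0_expand mulr_sumr; apply: eq_bigr => j _; rewrite mulrA.
Qed.

Lemma qpair_reduce m (v : 'I_m.+1 -> 'cV[L]_n) f d e : (0 < n)%N ->
  qpair v (f * altdet_row0 (fun x => fpow Y x (n + d)) e) =
  z * qpair v (f * altdet_row0 (fun x =>
        \prod_(n.+1 <= i < (n + d).+1) (x - (y i)%:MP)) e).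
Proof.
move=> n0; rewrite !altdet_row0_expand ![f * _]mulr_sumr !qpair_sum [z * _]mulr_sumr.
apply: eq_bigr => j _ /=; set c := cofactor _ _ _.
rewrite ![_ * c]mulrC !mulrA qpair_fpow mxfpow_cat //.
rewrite -scalemxAl /qpair pairing_scale; congr (_ * _).
by rewrite pairing_mul_prod.
Qed.

Lemma altdet_eq0 m e i1 i2 : (i1 < i2 < m)%N -> e i1 = e i2 ->
  altdet y m e = 0.
Proof.
move=> /andP[i12 i2m] ee; have i1m := ltn_trans i12 i2m.
apply: (@det_row_eq _ _ _ (Ordinal i1m) (Ordinal i2m)).
  by rewrite -val_eqE /= neq_ltn i12.
by move=> j /=; rewrite ee.
Qed.

(** The generators of the ideal of relations, multiplied by the Vandermonde.
    Modulo (x|y)^n = z the first row, of exponent n + i, becomes z times a monic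
    polynomial of degree i, of which only the multiple of (x|y)^m survives next
    to the rows of exponents m - 1, ..., 0. *)
Lemma qpair_relation m (v : 'I_m.+1 -> 'cV[L]_n) f i : (i <= m < n)%N ->
  qpair v (f * alternant y m.+1 [:: (n - m.+1 + i.+1)%N]) =
  if i == m then z * qpair v (f * vandermonde L m.+1) else 0.
Proof.
move=> /andP[im mn]; have n0 : (0 < n)%N by apply: leq_ltn_trans mn.
pose e r := (m.+1 - r.+1)%N.
rewrite alternantE -(@altdet_row0E _ _ e); last first.
  by case=> // r _; rewrite /part /= nth_nil.
have -> : (part [:: (n - m.+1 + i.+1)%N] 0 + (m.+1 - 1) = n + i)%N.
  by rewrite /part /=; lia.
rewrite qpair_reduce //.
have [c [ci _ cE]] := prod_lin_expand (Y : nat -> {mpoly L[m.+1]}) Y n i.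
have -> : altdet_row0 (fun x => \prod_(n.+1 <= j < (n + i).+1) (x - (y j)%:MP)) e =
    altdet_row0 (fun x => \sum_(s < i.+1) c s * fpow Y x s) e.
  by congr (\det _); apply/matrixP => a b; rewrite !mxE cE.
rewrite altdet_row0_sum big_ord_recr /= ci mul1r.
have e0 s : (s < m)%N -> altdet_row0 (fun x : {mpoly L[m.+1]} => fpow Y x s) e = 0.
  move=> sm; rewrite (@altdet_row0E _ (fun r => if r is 0 then s else e r)); last by case.
  apply: (@altdet_eq0 _ _ 0%N (m - s)%N); first by lia.
  by rewrite /e; case E: (m - s)%N => [|k]; lia.
rewrite big1 ?add0r; last by move=> s _; rewrite e0 ?mulr0 // (leq_trans (ltn_ord s)).
case: eqP => [->|ne]; last by rewrite e0 ?mulr0 ?qpair0 ?mulr0 //; lia.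
congr (_ * qpair v (f * _)).
have -> : altdet_row0 (fun x : {mpoly L[m.+1]} => fpow Y x m) e = altdet y m.+1 e.
  by rewrite -(@altdet_row0E _ e e) // {2}/e subn1.
rewrite -(alternant_nil y) alternantE.
by apply: eq_altdet => r rm; rewrite /part nth_nil.
Qed.

(** The first row (x|y)^n becomes z (x|y)^0, proportional to the last one. This
    handles the diagrams rho with a row of length n - k, which do not fit in the
    rectangle of Gr(k+1; n) and whose structure constants are zero by
    convention. *)
Lemma qpair_wide m (v : 'I_m.+1 -> 'cV[L]_n) f e : (0 < n)%N -> (0 < m)%N ->
  e 0%N = n -> e m = 0%N -> qpair v (f * altdet y m.+1 e) = 0.
Proof.
move=> n0 m0 e0 em; rewrite -(@altdet_row0E _ e e) // e0.
have -> : altdet_row0 (fun x : {mpoly L[m.+1]} => fpow Y x n) e =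
    altdet_row0 (fun x => fpow Y x (n + 0)) e by rewrite addn0.
rewrite qpair_reduce // addn0.
have -> : altdet_row0 (fun x : {mpoly L[m.+1]} => \prod_(n.+1 <= i < n.+1) (x - (y i)%:MP)) e =
    altdet_row0 (fun x => fpow Y x 0) e.
  by congr (\det _); apply/matrixP => a b; rewrite !mxE fpow0 big_geq.
rewrite (@altdet_row0E _ (fun r => if r is 0 then 0%N else e r)); last by case.
rewrite (@altdet_eq0 _ _ 0%N m) ?mulr0 ?qpair0 ?mulr0 ?m0 ?ltnS //=.
by case: m m0 em {v f}.
Qed.
End Companion.

(** * Diagrams, exponents and wedges *)

Section Words.
Local Open Scope nat_scope.

(** The exponents in the rows of the alternant of nu. They are the letters of
    [word nu] minus one, in decreasing order. *)
Definition dexp (nu : seq nat) (j : nat) : nat := part nu j + (size nu - j.+1).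

Lemma dexp_bound m l nu j : nu \in rect m l -> j < m -> dexp nu j < l + m.
Proof. by case/rectP => s le _ jm; rewrite /dexp s; move: (le j); lia. Qed.

Lemma dexp_dec m l nu i j : nu \in rect m l -> i < j < m -> dexp nu j < dexp nu i.
Proof.
case/rectP => s _ dec /andP[ij jm]; rewrite /dexp s.
by have := part_decreasing dec (ltnW ij); lia.
Qed.

Lemma dexp_inj m l nu i j : nu \in rect m l -> i < m -> j < m ->
  (dexp nu i == dexp nu j) = (i == j).
Proof.
move=> R im jm; apply/eqP/eqP => [e|->//]; case: (ltngtP i j) => // ij.
- by have := @dexp_dec _ _ _ i j R; rewrite ij jm e ltnn => /(_ isT).
- by have := @dexp_dec _ _ _ j i R; rewrite ij im e ltnn => /(_ isT).
Qed.

Lemma dexp_rect_inj m l nu nu' : nu \in rect m l -> nu' \in rect m l ->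
  (forall i, i < m -> dexp nu i = dexp nu' i) -> nu = nu'.
Proof.
move=> R R' e; apply: (rect_ext R R') => i im.
have [s _ _] := rectP _ _ _ R; have [s' _ _] := rectP _ _ _ R'.
by apply: (@addIn (m - i.+1)); have := e i im; rewrite /dexp s s'.
Qed.

Lemma size_word nu : size (word nu) = size nu.
Proof. by rewrite size_map size_iota. Qed.

Lemma nth_word nu p : p < size nu ->
  nth 0 (word nu) p = (dexp nu (size nu - p.+1)).+1.
Proof.
move=> ps; rewrite (nth_map 0) ?size_iota // nth_iota // /dexp add1n.
by lia.
Qed.

Lemma word_sorted m l nu : nu \in rect m l -> sorted ltn (word nu).
Proof.
move=> R; have [s _ _] := rectP _ _ _ R.
apply/(sortedP 0) => i; rewrite size_word s => im.
rewrite !nth_word ?s // 1?ltnW // /ltn /= ltnS; apply: (dexp_dec R); lia.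
Qed.

Lemma mem_word m l nu x : nu \in rect m l ->
  reflect (exists2 j, j < m & x = (dexp nu j).+1) (x \in word nu).
Proof.
move=> R; have [s _ _] := rectP _ _ _ R.
apply: (iffP (nthP 0)); rewrite size_word s.
  by case=> p pm <-; rewrite nth_word ?s //; exists (m - p.+1) => //; lia.
case=> j jm ->; exists (m - j.+1); first by lia.
by rewrite nth_word s; [congr (dexp _ _).+1; lia | lia].
Qed.

Lemma sorted_gap w p q : sorted ltn w -> p <= q < size w ->
  nth 0 w p + (q - p) <= nth 0 w q.
Proof.
move=> /(sortedP 0) sw; elim: q => [|q IH] pq.
  have -> : p = 0 by lia.
  by rewrite addn0.
case: (ltnP q p) => [qp|]; first by rewrite (_ : p = q.+1) ?subnn ?addn0 //; lia.
move=> pq'; have h1 : p <= q < size w by lia.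
have h2 : q.+1 < size w by lia.
by move: (IH h1) (sw _ h2); rewrite /ltn /=; lia.
Qed.

Lemma part_diag w i : i < size w ->
  part (diag w) i = nth 0 w (size w - i.+1) - (size w - i).
Proof.
move=> iw; rewrite /part /diag nth_rev size_map size_iota // (nth_map 0) ?size_iota; last by lia.
by rewrite nth_iota; [congr (_ - _); lia | lia].
Qed.

Lemma size_diag w : size (diag w) = size w.
Proof. by rewrite size_rev size_map size_iota. Qed.

Lemma diag_rect n w : sorted ltn w -> all (fun x => 0 < x <= n) w ->
  diag w \in rect (size w) (n - size w).
Proof.
move=> sw aw; apply/rectP; rewrite size_diag; split=> // i.
  case: (ltnP i (size w)) => iw; last by rewrite part_default ?size_diag.
  rewrite part_diag //.
  have h : size w - i.+1 <= (size w).-1 < size w by lia.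
  have l : (size w).-1 < size w by lia.
  by move: (sorted_gap sw h) (all_nthP 0 aw _ l); lia.
case: (ltnP i.+1 (size w)) => iw; last by rewrite part_default ?size_diag.
rewrite part_diag // part_diag; last exact: ltnW.
have h : size w - i.+2 <= size w - i.+1 < size w by lia.
by move: (sorted_gap sw h); lia.
Qed.

Lemma dexp_diag n w i : sorted ltn w -> all (fun x => 0 < x <= n) w ->
  i < size w -> dexp (diag w) i = (nth 0 w (size w - i.+1)).-1.
Proof.
move=> sw aw iw; rewrite /dexp size_diag part_diag //.
have h : 0 <= size w - i.+1 < size w by lia.
have l : 0 < size w by lia.
by move: (sorted_gap sw h) (all_nthP 0 aw _ l); lia.
Qed.

Lemma word_diag n w : sorted ltn w -> all (fun x => 0 < x <= n) w ->
  word (diag w) = w.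
Proof.
move=> sw aw; apply: (@eq_from_nth _ 0); rewrite size_word size_diag // => p pw.
rewrite nth_word ?size_diag // (dexp_diag sw aw); last by lia.
have -> : size w - (size w - p.+1).+1 = p by lia.
by have := all_nthP 0 aw p pw; lia.
Qed.

Lemma word_all m l nu : nu \in rect m l -> all (fun x => 0 < x <= l + m) (word nu).
Proof.
move=> R; apply/allP => x /(mem_word _ R)[j jm ->].
by rewrite /= (dexp_bound R).
Qed.

Lemma diag_word m l nu : nu \in rect m l -> diag (word nu) = nu.
Proof.
move=> R; have [s _ _] := rectP _ _ _ R.
have sw := word_sorted R; have aw := word_all R.
have := diag_rect sw aw; rewrite size_word s addnK => R'.
apply: (dexp_rect_inj R' R) => i im.
rewrite (dexp_diag sw aw) ?size_word ?s // nth_word ?s /=; last by lia.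
by congr (dexp _ _); lia.
Qed.

Lemma index_sorted w x : sorted ltn w -> x \in w ->
  index x w = count (ltn^~ x) w.
Proof.
elim: w => //= a w IH; rewrite (path_sortedE ltn_trans) => /andP[/allP aw sw].
rewrite inE; case: (eqVneq x a) => [->|xa] /= xw.
  rewrite ltnn add0n; apply/esym/eqP; rewrite -leqn0 leqNgt -has_count.
  by apply/hasPn => b /aw /ltnW; rewrite -leqNgt.
by rewrite IH // (aw _ xw).
Qed.

Lemma inversions_cons i w : sorted ltn w ->
  inversions (i :: w) = count (ltn^~ i) w.
Proof.
move=> sw; rewrite /inversions big_ord_recl /= big1 ?add0n //.
rewrite -sum1_count (big_nth 0) [RHS]big_mkcond big_mkord; apply: eq_bigr => j _ /=.
rewrite big_mkcond big_ord_recl /= big1 => [|k _]; first by rewrite addn0; case: ifP.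
case: ifP => //; rewrite /bump !add1n ltnS => kj.
have h : k <= j < size w by rewrite ltnW // ltn_ord.
by move: (sorted_gap sw h); rewrite !add0n; case: ltnP => //; lia.
Qed.

Lemma psi_diag_out i nu : i \notin word nu -> psi_diag i nu = (0%R, [::]).
Proof. by rewrite /psi_diag => /negbTE ->. Qed.

Lemma psi_star_diag_in i nu : i \in word nu -> psi_star_diag i nu = (0%R, [::]).
Proof. by rewrite /psi_star_diag /wedge /= => ->. Qed.

Lemma nth_rem (w : seq nat) x p : x \in w -> nth 0 (rem x w) p = nth 0 w (bump (index x w) p).
Proof.
move=> xw; rewrite remE nth_cat size_take index_mem xw /bump.
case: ltnP => pi; first by rewrite nth_take // leqNgt pi.
by rewrite nth_drop; congr nth; lia.
Qed.

(** The j-th exponent sits in position m - j of the increasing word, whence the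
    sign. *)
Lemma psi_diagE m n nu j : nu \in rect m.+1 (n - m.+1) -> m < n -> j <= m ->
  exists nu', [/\ psi_diag (dexp nu j).+1 nu = ((-1) ^+ (m - j)%N, nu')%R,
    nu' \in rect m (n - m),
    word nu' = rem (dexp nu j).+1 (word nu) &
    forall i, i < m -> dexp nu' i = dexp nu (bump j i)].
Proof.
move=> R mn jm; have [s _ _] := rectP _ _ _ R.
set w := word nu; set x := (dexp nu j).+1.
have sw : sorted ltn w := word_sorted R.
have aw : all (fun x => 0 < x <= n) w by have := word_all R; rewrite subnK.
have xw : x \in w by apply/(mem_word _ R); exists j.
have ix : index x w = m - j.
  have -> : x = nth 0 w (m - j).
    by rewrite nth_word s; [congr (dexp _ _).+1; lia | lia].
  rewrite index_uniq ?size_word ?s //; first by lia.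
  exact: sorted_uniq ltn_trans ltnn _ sw.
have sr : sorted ltn (rem x w) by apply: (subseq_sorted ltn_trans (rem_subseq _ _)).
have ar : all (fun x => 0 < x <= n) (rem x w).
  by apply/allP => a /mem_rem; apply: (allP aw).
have szr : size (rem x w) = m by rewrite size_rem // size_word s.
exists (diag (rem x w)); split.
- by rewrite /psi_diag -/w xw ix.
- by have := diag_rect sr ar; rewrite szr.
- exact: word_diag sr ar.
move=> i im; rewrite (dexp_diag sr ar) szr // nth_rem // ix nth_word ?s; last first.
  by rewrite /bump; lia.
by congr (dexp _ _); rewrite /bump; lia.
Qed.

(** Inserting a letter is inverse to removing it, with the same sign: the number
    of inversions created in front of the word is the position of the letter in
    the sorted word. *)
Lemma psi_star_diagE m n nu x : nu \in rect m (n - m) -> m < n ->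
  0 < x <= n -> x \notin word nu ->
  exists nu' p, [/\ p <= m, psi_star_diag x nu = ((-1) ^+ (m - p)%N, nu')%R,
    nu' \in rect m.+1 (n - m.+1), dexp nu' p = x.-1 &
    forall i, i < m -> dexp nu i = dexp nu' (bump p i)].
Proof.
move=> R mn xn xw; have [s _ _] := rectP _ _ _ R.
have sw := word_sorted R; have aw := word_all R.
rewrite subnK in aw; last exact: ltnW.
set w := word nu in xw sw aw *; pose w' := sort leq (x :: w).
have pw : perm_eq w' (x :: w) by rewrite perm_sort.
have uw : uniq (x :: w) by rewrite /= xw (sorted_uniq ltn_trans ltnn sw).
have sw' : sorted ltn w'.
  by rewrite ltn_sorted_uniq_leq sort_uniq uw sort_sorted //; exact: leq_total.
have aw' : all (fun x => 0 < x <= n) w' by rewrite (perm_all _ pw) /= xn.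
have szw' : size w' = m.+1 by rewrite (perm_size pw) /= size_word s.
have xw' : x \in w' by rewrite (perm_mem pw) mem_head.
have R' : diag w' \in rect m.+1 (n - m.+1) by have := diag_rect sw' aw'; rewrite szw'.
have ww' := word_diag sw' aw'.
have [p pm ex] : exists2 p, p < m.+1 & x = (dexp (diag w') p).+1.
  by apply/(mem_word _ R'); rewrite ww'.
exists (diag w'), p; have [nu1 [e1 R1 w1 d1]] := psi_diagE R' mn pm.
have nu1E : nu1 = nu.
  rewrite -(diag_word R1) -(diag_word R); congr diag.
  rewrite w1 ww' -ex.
  apply: (irr_sorted_eq ltn_trans ltnn) => //.
    by apply: (subseq_sorted ltn_trans (rem_subseq _ _)).
  move=> a; rewrite mem_rem_uniq ?sort_uniq // !inE (perm_mem pw) inE.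
  by case: (eqVneq a x) => [->|//]; rewrite (negbTE xw).
split=> //.
- rewrite /psi_star_diag /wedge -/w uw -/w'; congr (_ , _)%R.
  rewrite inversions_cons //.
  have -> : count (ltn^~ x) w = count (ltn^~ x) w'.
    by rewrite (seq.permP pw) /= ltnn.
  rewrite -index_sorted //; move: e1; rewrite /psi_diag ww' -ex xw'.
  by case.
- by rewrite ex.
- by move=> i im; rewrite -d1 ?nu1E.
Qed.

End Words.

(** * Removing and adding one tensor factor *)

Section Recursions.
Variables (L : idomainType) (n : nat) (y : nat -> L) (z : L).
Local Notation Y := (fun i => (y i)%:MP).
Local Notation X := (companion n y z).
Local Notation qpair := (qpair y z).
Local Notation erow := (erow L n).
Local Notation ecol := (ecol L n).
Local Notation mxfpow := (mxfpow n y z).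

Definition strip_mx (m : nat) (lam rho : seq nat) : 'M[L]_n :=
  \prod_(b <- boxes lam rho) (X - (y (m + b.2 - b.1))%:M).

Lemma widen_lift m (j : 'I_m) : widen j = lift ord_max j.
Proof. by apply: val_inj; rewrite /= /bump leqNgt ltn_ord. Qed.

Lemma mulr3CA (R : comNzRingType) (a b c d : R) :
  a * (b * (c * d)) = c * (a * (b * d)).
Proof. by ring. Qed.

(** A minor of an alternant is an alternant in the remaining variables. The
    permutation makes the removed variable the last one. *)
Lemma cofactor_altdet m (e : nat -> nat) (i p : 'I_m.+1) :
  cofactor (\matrix_(a < m.+1, b < m.+1) fpow (Y : nat -> {mpoly L[m.+1]}) 'X_b (e a)) i p
  = (-1) ^+ (i + p) *
    msym (lift_perm ord_max p 1) (mwiden (altdet y m (fun a => e (bump i a)))).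
Proof.
rewrite /cofactor mwiden_altdet -det_map_mx; congr (_ * \det _).
apply/matrixP => a b; rewrite !mxE.
have -> : 'X_(lift p b) = msym (lift_perm ord_max p 1) 'X_(widen b) :> {mpoly L[m.+1]}.
  by rewrite msym_U widen_lift lift_perm_lift perm1.
by rewrite -msym_fpow.
Qed.

Lemma qpair_strip m (v : 'I_m.+1 -> 'cV[L]_n) f lam rho :
  qpair v (f * strip_weight y m lam rho) =
  qpair [eta v with ord_max |-> strip_mx m.+1 lam rho *m v ord_max] f.
Proof. exact: pairing_mul_prod. Qed.

Lemma qpair_mwiden m (v : 'I_m.+1 -> 'cV[L]_n) f :
  qpair v (mwiden f) = qpair (fun j => v (widen j)) f * (erow 1 *m v ord_max) ord0 ord0.
Proof. exact: pairing_mwiden. Qed.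

Lemma qpair_msym m (v : 'I_m -> 'cV[L]_n) (s : 'S_m) f :
  qpair v (msym s f) = qpair (v \o s) f.
Proof. exact: pairing_msym. Qed.

(** Expansion of the alternant along row i. In the term of column p the
    symmetry of the factorial Schur polynomial moves x_p to the last place, where
    the branching rule splits it off. *)
Lemma horizontal_recursion m l lam (d e : nat -> nat) (i : 'I_m.+1) :
  lam \in rect m.+1 l -> (e i < n)%N ->
  qpair (fun j : 'I_m.+1 => ecol (d j)) (fschur y m.+1 lam * altdet y m.+1 e) =
  \sum_(p < m.+1) (-1) ^+ (i + p) *
    \sum_(rho <- rect m l | hstrip lam rho)
      (erow (e i).+1 *m strip_mx m.+1 lam rho *m ecol (d p)) ord0 ord0 *
      qpair (fun j : 'I_m => ecol (d (bump p j)))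
        (fschur y m rho * altdet y m (fun a => e (bump i a))).
Proof.
move=> lamR ein.
rewrite [altdet y m.+1 e]/altdet (expand_det_row _ i) mulr_sumr qpair_sum.
apply: eq_bigr => p _.
rewrite mxE cofactor_altdet; set s := lift_perm _ _ _.
rewrite -(msym_fschur y s lamR).
have -> : fpow Y 'X_p (e i) = msym s (fpow Y 'X_ord_max (e i)).
  by rewrite msym_fpow msym_U lift_perm_id.
have -> : (-1) ^+ (i + p) = ((-1) ^+ (i + p) : L)%:MP :> {mpoly L[m.+1]}.
  by rewrite rmorphXn rmorphN1.
rewrite mulr3CA qpairC; congr (_ * _).
rewrite -!rmorphM /= qpair_msym (fschur_horizontal y lamR) mulr_suml qpair_sum.
apply: eq_bigr => rho _.
set a := altdet _ _ _.
have -> : strip_weight y m lam rho * mwiden (fschur y m rho) *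
    (fpow Y 'X_ord_max (e i) * mwiden a) =
    mwiden (fschur y m rho * a) * fpow Y 'X_ord_max (e i) * strip_weight y m lam rho.
  by rewrite rmorphM /=; ring.
rewrite qpair_strip qpair_fpow qpair_mwiden mulrC /=.
congr (_ * _); last first.
  apply: eq_pairing => j /=.
  have wm : (widen j == ord_max) = false by rewrite -val_eqE /= ltn_eqF.
  by rewrite !wm /s widen_lift lift_perm_lift perm1.
by rewrite !eqxx /s lift_perm_id mulmxA erow_mxfpow // mulmxA.
Qed.

Definition extend_slot m (w : nat -> 'cV[L]_n) (c : 'cV[L]_n) (j : 'I_m.+1) :=
  if (j < m)%N then w j else c.

(** Contraction of the last variable with the coordinate c removes the wedge
    factor c. *)
Lemma qpair_extend_slot m (w : nat -> 'cV[L]_n) c f (e : nat -> nat) (p : 'I_m.+1) :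
  (forall i : 'I_m.+1, e i < n)%N ->
  (forall i : 'I_m.+1, (e i == c) = (i == p)) ->
  qpair (extend_slot (m:=m) w (ecol c)) (mwiden f * altdet y m.+1 e) =
  (-1) ^+ (m - p) *
    qpair (fun j : 'I_m => w j) (f * altdet y m (fun a => e (bump p a))).
Proof.
move=> en ec.
rewrite [altdet y m.+1 e]/altdet (expand_det_col _ ord_max) mulr_sumr qpair_sum.
transitivity (\sum_(i < m.+1) (-1) ^+ (m - i) *
   (qpair (fun j : 'I_m => w j) (f * altdet y m (fun a => e (bump i a))) *
     (e i == c)%:R)).
  apply: eq_bigr => i _.
  rewrite mxE cofactor_altdet.
  have -> : lift_perm ord_max ord_max 1 = 1%g :> 'S_m.+1 by rewrite lift_perm1.
  rewrite msym1m /=.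
  have -> : (-1) ^+ (i + m) = ((-1) ^+ (m - i) : L)%:MP :> {mpoly L[m.+1]}.
    rewrite rmorphXn rmorphN1 -signr_odd oddD -[in RHS]signr_odd oddB -1?ltnS //.
    by rewrite addbC.
  rewrite mulr3CA qpairC; congr (_ * _).
  rewrite mulrCA mulrC -rmorphM /= qpair_fpow qpair_mwiden /= eqxx /extend_slot ltnn.
  rewrite mulmxA erow_mxfpow // erow_ecol //; congr (_ * _).
  apply: eq_pairing => j /=.
  have wm : (widen j == ord_max) = false by rewrite -val_eqE /= ltn_eqF.
  by rewrite wm /= ltn_ord.
rewrite (bigD1 p) //= big1 => [|i ip]; last first.
  by rewrite ec (negbTE ip) [X in _ * X = _]mulr0 mulr0.
by rewrite addr0 ec eqxx; congr (_ * _); rewrite -[RHS]mulr1.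
Qed.

(** The factors attached to the strip are moved to the covector c of the last
    variable, and its image is expanded in the coordinate forms. *)
Lemma vertical_recursion m l lam (w : nat -> 'cV[L]_n) c a : lam \in rect m l ->
  qpair (extend_slot (m:=m) w c) (mwiden (fschur y m lam) * a) =
  \sum_(rho <- rect m l | vstrip lam rho) (-1) ^+ size (boxes lam rho) *
    \sum_(r < n) (erow r.+1 *m strip_mx m.+1 lam rho *m c) ord0 ord0 *
     qpair (extend_slot (m:=m) w (ecol r)) (fschur y m.+1 (rcons rho 0%N) * a).
Proof.
move=> lamR; rewrite (fschur_vertical y lamR) mulr_suml qpair_sum.
apply: eq_bigr => rho _.
have -> : (-1) ^+ size (boxes lam rho) =
    ((-1) ^+ size (boxes lam rho) : L)%:MP :> {mpoly L[m.+1]}.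
  by rewrite rmorphXn rmorphN1.
rewrite -!mulrA qpairC; congr (_ * _).
rewrite mulrC qpair_strip.
have -> : strip_mx m.+1 lam rho *m extend_slot (m:=m) w c ord_max =
    \sum_(r < n) (erow r.+1 *m strip_mx m.+1 lam rho *m c) ord0 ord0 *: ecol r.
  rewrite /extend_slot ltnn; set b := _ *m c.
  under eq_bigr => r _ do rewrite -mulmxA -/b erow_mul mxE.
  apply/colP => r.
  rewrite summxE (bigD1 r) //= big1 => [|k kr].
    by rewrite !mxE eqxx mulr1 addr0.
  by rewrite !mxE eqSS val_eqE eq_sym (negbTE kr) mulr0.
rewrite /qpair pairing_slot_sum; apply: eq_bigr => r _; congr (_ * _).
apply: eq_pairing => j /=; rewrite /extend_slot -val_eqE /=.
by case: (ltngtP j m) => // mj; have := ltn_ord j; rewrite ltnS leqNgt mj.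
Qed.

Lemma msym_fschur_altdet m (s : 'S_m) l lam e : lam \in rect m l ->
  msym s (fschur y m lam * altdet y m e) =
  (((-1) ^+ s : L)%:MP) * (fschur y m lam * altdet y m e).
Proof.
move=> lamR; rewrite rmorphM /= (msym_fschur _ _ lamR) msym_altdet mulrCA.
by rewrite rmorphXn rmorphN1.
Qed.

(** Exchanging the two variables with equal covectors preserves the value and
    changes the sign of the polynomial. *)
Lemma qpair_repeated m (v : 'I_m -> 'cV[L]_n) l lam e j1 j2 :
  2%:R != 0 :> L -> lam \in rect m l -> j1 != j2 -> v j1 = v j2 ->
  qpair v (fschur y m lam * altdet y m e) = 0.
Proof.
move=> two lamR j12 vj.
have := msym_fschur_altdet (tperm j1 j2) e lamR.
move/(congr1 (qpair v)); rewrite qpairC odd_tperm j12 expr1 mulN1r qpair_msym.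
rewrite (@eq_qpair _ _ y z _ _ v) => [|j /=]; last first.
  by case: tpermP => [->|->|].
move/eqP; rewrite -subr_eq0 opprK -mulr2n -mulr_natl mulf_eq0 (negbTE two).
by move/eqP.
Qed.

Lemma qpair_lift m (d : nat -> nat) l lam e (p : 'I_m.+1) : lam \in rect m.+1 l ->
  qpair (extend_slot (m:=m) (fun j => ecol (d (bump p j))) (ecol (d p)))
     (fschur y m.+1 lam * altdet y m.+1 e) =
  (-1) ^+ (m - p) * qpair (fun j : 'I_m.+1 => ecol (d j))
     (fschur y m.+1 lam * altdet y m.+1 e).
Proof.
move=> lamR; pose s : 'S_m.+1 := lift_perm ord_max p 1.
rewrite (@eq_qpair _ _ y z _ _ ((fun j : 'I_m.+1 => ecol (d j)) \o s)); last first.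
  move=> j; rewrite /extend_slot /=; case: (unliftP ord_max j) => [j'|] ->.
    by rewrite /s lift_perm_lift perm1 lift_max ltn_ord.
  by rewrite /s lift_perm_id ltnn.
rewrite -qpair_msym (msym_fschur_altdet _ _ lamR) qpairC; congr (_ * _).
rewrite odd_lift_perm odd_perm1 addbF signr_addb !signr_odd.
by rewrite -signr_odd -[in X in _ * X]signr_odd -signr_addb -[RHS]signr_odd oddB -1?ltnS.
Qed.

End Recursions.

(** * Structure constants as coordinates *)

Section Transport.
Variables (L L' : idomainType) (g : {rmorphism L -> L'}) (n : nat).
Variables (y : nat -> L) (y' : nat -> L').
Hypothesis gy : forall i, g (y i) = y' i.

Lemma map_mpoly_U m (j : 'I_m) : map_mpoly g 'X_j = 'X_j.
Proof. exact: map_mpolyX. Qed.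

Lemma map_mpoly_fpow m (p : {mpoly L[m]}) e :
  map_mpoly g (fpow (fun i => (y i)%:MP) p e) =
  fpow (fun i => (y' i)%:MP) (map_mpoly g p) e.
Proof.
rewrite rmorph_prod; apply: eq_bigr => i _.
by rewrite rmorphB /= map_mpolyC; congr (_ - _%:MP); apply: gy.
Qed.

Lemma map_mpoly_altdet m e : map_mpoly g (altdet y m e) = altdet y' m e.
Proof.
rewrite /altdet -det_map_mx; congr (\det _); apply/matrixP => i j.
by rewrite !mxE -map_mpoly_U -map_mpoly_fpow.
Qed.

Lemma map_mpoly_fschur m l lam : lam \in rect m l ->
  map_mpoly g (fschur y m lam) = fschur y' m lam.
Proof.
move=> lamR; apply: vandermonde_cancel; rewrite (fschur_rectE _ lamR).
rewrite -(alternant_nil y') !alternantE -!map_mpoly_altdet -rmorphM /=.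
by rewrite -!alternantE alternant_nil (fschur_rectE _ lamR).
Qed.

Lemma map_pairing m (u : 'rV_n) (M : 'M_n) (v : 'I_m -> 'cV[L]_n) f :
  g (pairing u M v f) =
  pairing (map_mx g u) (map_mx g M) (fun j => map_mx g (v j)) (map_mpoly g f).
Proof.
elim/mpolyind: f => [|c a f _ _ IH]; first by rewrite !raddf0.
rewrite !raddfD /= IH map_mpolyZ !pairingZ rmorphM map_mpolyX !pairingX.
congr (_ * _ + _); rewrite rmorph_prod; apply: eq_bigr => j _.
have -> : map_mx g M ^+ a j = map_mx g (M ^+ a j).
  elim: (a j) => [|k IHk]; first by rewrite !expr0 map_mx1.
  by rewrite !exprS IHk -!mulmxE map_mxM.
by rewrite -!map_mxM [RHS]mxE.
Qed.

Lemma map_companion z : map_mx g (companion n y z) = companion n y' (g z).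
Proof.
apply/matrixP => i j; rewrite !mxE rmorphD rmorphM /= rmorph_nat gy; congr (_ + _).
by case: ifP => _; rewrite !mxE ?rmorphM ?rmorph_nat.
Qed.

Lemma map_erow i : map_mx g (erow L n i) = erow L' n i.
Proof. by apply/rowP => j; rewrite !mxE rmorph_nat. Qed.

(** The polynomials are given by integral formulas in the y_i, so a ring morphism
    acts through the images of z and of the y_i alone. *)
Lemma map_qpair m z (d : nat -> nat) l lam e : lam \in rect m l ->
  g (qpair y z (fun j : 'I_m => ecol L n (d j)) (fschur y m lam * altdet y m e)) =
  qpair y' (g z) (fun j : 'I_m => ecol L' n (d j))
    (fschur y' m lam * altdet y' m e).
Proof.
move=> lamR; rewrite map_pairing map_erow map_companion rmorphM /=.
rewrite (map_mpoly_fschur lamR) map_mpoly_altdet; apply: eq_pairing => j.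
by rewrite -map_trmx map_erow.
Qed.
End Transport.

Lemma sum_delta (R : pzRingType) (T : eqType) (s : seq T) (c : T -> R) x :
  uniq s -> x \in s -> \sum_(k <- s) c k * (k == x)%:R = c x.
Proof.
move=> us xs; rewrite (bigD1_seq x) //= eqxx mulr1 big1 ?addr0 // => k /negbTE ->.
by rewrite mulr0.
Qed.

Lemma alternant_dexp (L : idomainType) (y : nat -> L) m nu : size nu = m ->
  alternant y m nu = altdet y m (dexp nu).
Proof. by move=> s; rewrite alternantE /dexp s. Qed.

Section StructureConstants.
Variables (L : idomainType) (n : nat) (y : nat -> L) (z : L).

(** The wedges of the diagrams in the rectangle and their coordinates are dual
    bases. *)
Lemma qpair_dexp m k nu : (m <= n)%N ->
  k \in rect m (n - m) -> nu \in rect m (n - m) ->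
  qpair y z (fun j : 'I_m => ecol L n (dexp nu j)) (alternant y m k) =
  (k == nu)%:R.
Proof.
move=> mn kR nuR; have [sk _ _] := rectP _ _ _ kR; have [sn _ _] := rectP _ _ _ nuR.
rewrite alternant_dexp // (qpair_altdet_ecol y z (dexp nu)) => [|i im]; last first.
  by have := dexp_bound kR im; rewrite subnK.
case: eqP => [->|ne].
  rewrite (_ : \matrix_(_, _) _ = 1%:M) ?det1 //; apply/matrixP => i j.
  by rewrite !mxE (dexp_inj nuR) ?ltn_ord.
case: (boolP [forall i : 'I_m, (dexp k i).+1 \in word nu]) => [/forallP all_in|].
  case: ne; rewrite -(diag_word kR) -(diag_word nuR); congr diag.
  (* two increasing words of the same length, one contained in the other *)
  have sub : {subset word k <= word nu}.
    by move=> x /(mem_word _ kR)[j jm ->]; apply: (all_in (Ordinal jm)).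
  apply: (irr_sorted_eq ltn_trans ltnn (word_sorted kR) (word_sorted nuR)).
  have uk := sorted_uniq ltn_trans ltnn (word_sorted kR).
  by have [] := uniq_min_size uk sub; rewrite ?size_word ?sk ?sn.
rewrite negb_forall => /existsP[i ni].
rewrite (expand_det_row _ i) big1 // => j _; rewrite mxE.
case: eqP => [e|_]; last by rewrite mul0r.
by case/negP: ni; apply/(mem_word _ nuR); exists j; rewrite ?e.
Qed.

(** The expansion of a product of Schubert classes is multiplied by the
    Vandermonde; the relations disappear by [qpair_relation], where the two
    contributions z and (-1)^m q of the last one cancel. *)
Lemma structure_qpair m (C : seq nat -> L) q lam mu nu
    (a : 'I_m -> {mpoly L[m]}) :
  (m <= n)%N -> ((0 < m)%N -> z = (-1) ^+ m.-1 * q) ->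
  mu \in rect m (n - m) -> nu \in rect m (n - m) ->
  fschur y m lam * fschur y m mu -
    \sum_(nu <- rect m (n - m)) C nu *: fschur y m nu =
  \sum_i a i * (fschur y m [:: (n - m + i.+1)%N] +
    (if i.+1 == m then ((-1) ^+ m * q)%:MP else 0)) ->
  C nu = qpair y z (fun j : 'I_m => ecol L n (dexp nu j))
           (fschur y m lam * altdet y m (dexp mu)).
Proof.
move=> mn hz muR nuR rel; set v := fun j : 'I_m => _.
have [smu _ _] := rectP _ _ _ muR.
rewrite -alternant_dexp // -(fschur_rectE y muR) mulrA.
move/(canRL (subrK _)): rel => ->; rewrite mulrDl qpairD.
have -> : qpair y z v ((\sum_i a i * (fschur y m [:: (n - m + i.+1)%N] +
    (if i.+1 == m then ((-1) ^+ m * q)%:MP else 0))) * vandermonde L m) = 0.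
  rewrite mulr_suml qpair_sum big1 // => i _.
  case: m mn hz muR nuR v a smu i => [|m] mn hz _ _ v a _ i; first by case: i.
  have im : (i <= m < n)%N by rewrite -ltnS ltn_ord mn.
  rewrite -mulrA mulrDl fschurE; last by case.
  rewrite mulrDr qpairD qpair_relation // eqSS hz //; case: ifP => _.
    by rewrite mulrCA qpairC exprS /=; ring.
  by rewrite mul0r mulr0 qpair0 addr0.
rewrite add0r mulr_suml qpair_sum -(@sum_delta _ _ _ C nu (rect_uniq m (n - m)) nuR).
apply: eq_big_seq => k kR.
by rewrite -scalerAl qpairZ (fschur_rectE _ kR) qpair_dexp.
Qed.

Lemma qpair_rcons_wide m (v : 'I_m.+1 -> 'cV[L]_n) rho mu : (0 < m < n)%N ->
  rho \in rect m (n - m) -> rcons rho 0%N \notin rect m.+1 (n - m.+1) ->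
  mu \in rect m.+1 (n - m.+1) ->
  qpair y z v (fschur y m.+1 (rcons rho 0%N) * altdet y m.+1 (dexp mu)) = 0.
Proof.
move=> /andP[m0 mn] rhoR wide muR; have [smu _ _] := rectP _ _ _ muR.
have rR := rect_rcons0 rhoR; have [sr le dec] := rectP _ _ _ rR.
have first : part (rcons rho 0%N) 0 = (n - m)%N.
  apply/eqP; rewrite eqn_leq le leqNgt; apply: contra wide => lt.
  apply/rectP; split=> // i; have := part_decreasing dec (leq0n i); lia.
rewrite -alternant_dexp // -(fschur_rectE y muR) mulrCA (fschur_rectE y rR) alternant_dexp //.
apply: qpair_wide => //.
  by rewrite /dexp sr first; lia.
have [srho _ _] := rectP _ _ _ rhoR.
by rewrite /dexp sr subnn addn0 /part nth_rcons srho ltnn eqxx.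
Qed.

Lemma mul_ecol (u : 'rV[L]_n) (r : 'I_n) : (u *m ecol L n r) ord0 ord0 = u ord0 r.
Proof.
rewrite mxE (bigD1 r) //= !mxE eqxx mulr1 big1 ?addr0 // => k kr.
by rewrite !mxE eqSS val_eqE (negbTE kr) mulr0.
Qed.

(** The order of the factors is reversed by transposition, and immaterial. *)
Lemma tr_strip m lam rho : (strip_mx n y z m lam rho)^T =
  \prod_(b <- boxes lam rho) (companion n y z - (y (m + b.2 - b.1))%:M)^T.
Proof.
rewrite /strip_mx; elim: (boxes lam rho) => [|b s IH]; first by rewrite !big_nil trmx1.
rewrite !big_cons -IH -!mulmxE -trmx_mul; congr (_^T).
by apply: commr_prod => i _; apply: comm_companion.
Qed.

End StructureConstants.

Section QuantumSchubert.
Variable n : nat.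
Local Notation L := (coefring n).
Local Notation y := (yvar n).

Lemma negq_yvar j : laurent_negq (y j) = y j.
Proof. exact: laurent_negqC. Qed.

Lemma two_neq0 : 2%:R != 0 :> L.
Proof.
apply/eqP => /(congr1 val); rewrite rmorph_nat rmorph0 => /eqP.
rewrite -(rmorph_nat (@tofrac {poly {mpoly int[n]}})) tofrac_eq0.
by rewrite -polyC_natr polyC_eq0 -mpolyC_nat mpolyC_eq0.
Qed.

Lemma transE k j : trans n k j = companion n y (zvar n k) - (y j)%:M.
Proof.
apply/matrixP => i r; rewrite !mxE /psi_star eqSS [i.+1 == n.+1]eqSS.
rewrite [_ == n :> nat in X in _ + X]ltn_eqF // -addrA; congr (_ + _).
by rewrite !mxE eqSS val_eqE (eq_sym i r) mulrBl [y j * _]mulr_natr.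
Qed.

(** The operators on the psi are adjoint to those on their duals: the
    parameter z of psi_0 := z psi_n is the corner entry of the transposed
    companion matrix. *)
Lemma trans_invE k j :
  trans_inv n k j = (companion n y (zvar n k) - (y j)%:M)^T.
Proof.
rewrite -transE; apply/matrixP => i r; rewrite !mxE.
congr (_ + _); last first.
  rewrite /psi_star [r.+1 == n.+1]eqSS (ltn_eqF (ltn_ord r)) /= !mxE (eq_sym i.+1).
  case: eqP => [e|_]; first by rewrite e.
  by rewrite [LHS]mulr0 [RHS]mulr0.
rewrite /psi /psi_star eqSS; case: i => [[|i] im] /=.
  case: ifP => rn; rewrite !mxE ?eqxx ?rn //.
  by rewrite mulr0.
case: ifP => rn; rewrite !mxE /=; last by rewrite !eqSS eq_sym.
by rewrite [RHS]mulr0 (eqP rn) gtn_eqF.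
Qed.

Lemma AcoefE k lam rho i (r : 'I_n) : (i <= n)%N ->
  Acoef k lam rho i r =
  (erow L n i *m strip_mx n y (zvar n k) k lam rho *m ecol L n r) ord0 ord0.
Proof.
move=> i_n; rewrite mul_ecol /Acoef /psi_star ltn_eqF // /strip_mx.
by congr ((_ *m _) _ _); apply: eq_bigr => b _; rewrite transE.
Qed.

Lemma BcoefE k lam rho i (r : 'I_n) :
  Bcoef k lam rho i.+1 r =
  (erow L n r.+1 *m strip_mx n y (zvar n k) k.+1 lam rho *m ecol L n i) ord0 ord0.
Proof.
rewrite /Bcoef /psi /= /strip_mx.
have -> : \prod_(b <- boxes lam rho) trans_inv n k (k.+1 + b.2 - b.1) =
   (strip_mx n y (zvar n k) k.+1 lam rho)^T.
  by rewrite tr_strip; apply: eq_bigr => b _; rewrite trans_invE.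
rewrite -[in LHS](trmxK (Defs.basis n i.+1)) -trmx_mul mxE.
by rewrite erow_mul -row_mul [RHS]mxE.
Qed.

End QuantumSchubert.

(** * The two recursions *)

Lemma mulr_swap (R : comPzRingType) (a b c d : R) :
  a * b * (c * d) = b * c * (a * d).
Proof. by rewrite [a * b]mulrC -!mulrA; congr (_ * _); rewrite mulrCA. Qed.

Section Final.
Variable n : nat.
Local Notation L := (coefring n).
Local Notation y := (yvar n).
Local Notation SC := (seq nat -> seq nat -> seq nat -> L).

Lemma rect_widen m l l' s : (l <= l')%N -> s \in rect m l -> s \in rect m l'.
Proof.
move=> ll' /rectP[ss le dec]; apply/rectP; split=> // i.
exact: leq_trans (le i) ll'.
Qed.

(** For m = 0 there is no variable and z is arbitrary. *)
Lemma structure_constantsE m (C : SC) z lam mu nu : (m <= n)%N ->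
  structure_constants m C -> ((0 < m)%N -> z = (-1) ^+ m.-1 * qvar n) ->
  lam \in rect m (n - m) -> mu \in rect m (n - m) -> nu \in rect m (n - m) ->
  C lam mu nu = qpair y z (fun j : 'I_m => ecol L n (dexp nu j))
           (fschur y m lam * altdet y m (dexp mu)).
Proof.
move=> mn [hC _] hz lamR muR nuR; have [a [_ rel]] := hC lam mu lamR muR.
exact: (structure_qpair mn hz muR nuR rel).
Qed.

Definition negq : {rmorphism L -> L} := @laurent_negq {mpoly int[n]}.

Lemma negq_Nzvar k : negq (- zvar n k) = zvar n k.
Proof.
have e : negq (qvar n) = - qvar n by exact: laurent_negq_q.
by rewrite /zvar rmorphN rmorphM rmorph_sign e mulrN opprK.
Qed.

(** For k = m + 1 and k = m - 1 the parameter z of Gr(k; n) is the one of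
    Gr(m; n) after q := -q. *)
Lemma structure_constants_negq m k (C : SC) lam mu nu : (m <= n)%N ->
  structure_constants m C -> ((0 < m)%N -> odd m = odd k.-1) ->
  lam \in rect m (n - m) -> mu \in rect m (n - m) -> nu \in rect m (n - m) ->
  laurent_negq (C lam mu nu) =
  qpair y (zvar n k) (fun j : 'I_m => ecol L n (dexp nu j))
     (fschur y m lam * altdet y m (dexp mu)).
Proof.
move=> mn hC mk lamR muR nuR.
rewrite (structure_constantsE (z := - zvar n k) mn hC) //; last first.
  case: m mk {mn hC lamR muR nuR} => // m mk _ /=.
  rewrite /zvar -(signr_odd _ k.-1) -mk // signr_odd exprS mulN1r.
  by rewrite mulNr opprK.
(* the value of z for (m, q) is - zvar n k, which q := -q turns into zvar n k *)
have E := @map_qpair L L negq n y y (@negq_yvar n) m (- zvar n k) (dexp nu)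
  _ lam (dexp mu) lamR.
by rewrite negq_Nzvar in E; exact: E.
Qed.

Lemma negq_signed_constant (C : SC) rho (b a : sdiagram) s t c d :
  b = ((-1) ^+ s, c) -> a = ((-1) ^+ t, d) ->
  laurent_negq (signed_constant C rho b a) =
    (-1) ^+ (t + s) * laurent_negq (C rho c d).
Proof.
move=> -> ->; rewrite /signed_constant /= -exprD.
have -> : ((-1) ^+ (t + s))%:~R = (-1) ^+ (t + s) :> L by rewrite rmorph_sign.
by have := rmorphM negq ((-1) ^+ (t + s)) (C rho c d); rewrite rmorph_sign.
Qed.

Lemma negq_signed_constant0 (C : SC) rho (b a : sdiagram) :
  a.1 = 0 -> laurent_negq (signed_constant C rho b a) = 0.
Proof.
by move=> a0; rewrite /signed_constant a0 mul0r mul0r; exact: (rmorph0 negq).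
Qed.

Section Recursion.
Variable C : nat -> SC.
Hypothesis hC : forall m : nat, (m <= n)%N -> structure_constants m (C m).
Variables lam mu nu : seq nat.

Lemma horizontal_formula m j : (m < n)%N -> (j <= m)%N ->
  lam \in rect m.+1 (n - m.+1) -> mu \in rect m.+1 (n - m.+1) ->
  nu \in rect m.+1 (n - m.+1) ->
  C m.+1 lam mu nu =
  \sum_(r < n) \sum_(rho <- rect m (n - m.+1) | hstrip lam rho)
     Acoef m.+1 lam rho (dexp mu j).+1 r *
     laurent_negq (signed_constant (C m) rho
       (psi_diag (dexp mu j).+1 mu) (psi_diag r.+1 nu)).
Proof.
move=> mn jm lamR muR nuR.
have [mu' [muE muR' _ dmu]] := psi_diagE muR mn jm.
have jm1 : (j < m.+1)%N by [].
have dlt s p : s \in rect m.+1 (n - m.+1) -> (p < m.+1)%N -> (dexp s p < n)%N.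
  by move=> sR pm; have := dexp_bound sR pm; rewrite subnK.
pose h (p : 'I_m.+1) : 'I_n := Ordinal (dlt _ _ nuR (ltn_ord p)).
rewrite (@structure_constantsE _ _ (zvar n m.+1) _ _ _ mn (hC mn)) //.
rewrite (horizontal_recursion y _ (dexp nu) (i := Ordinal jm1) lamR);
  last exact: (dlt mu j muR jm1).
pose F (r : 'I_n) := \sum_(rho <- rect m (n - m.+1) | hstrip lam rho)
     Acoef m.+1 lam rho (dexp mu j).+1 r *
     laurent_negq (signed_constant (C m) rho
       (psi_diag (dexp mu j).+1 mu) (psi_diag r.+1 nu)).
transitivity (\sum_(p <- index_enum 'I_m.+1) F (h p)); last apply: sum_seq_inj.
- apply: eq_bigr => p _; rewrite mulr_sumr /F big_seq_cond [RHS]big_seq_cond.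
  apply: eq_bigr => rho /andP[rhoR _].
  have [nu' [nuE nuR' _ dnu]] := psi_diagE nuR mn (leq_ord p).
  rewrite (negq_signed_constant _ _ muE nuE) AcoefE; last exact: (dlt mu j muR jm1).
  have rhoR' : rho \in rect m (n - m) by apply: rect_widen rhoR; lia.
  rewrite (structure_constants_negq (k := m.+1) (ltnW mn) (hC (ltnW mn))
    (fun _ => erefl) rhoR' muR' nuR').
  have vE : (fun i : 'I_m => ecol L n (dexp nu' i)) =1
      (fun i => ecol L n (dexp nu (bump p i))) by move=> i; rewrite dnu.
  rewrite (@eq_qpair _ _ _ _ _ _ _ _ vE).
  rewrite (eq_altdet y (l := dexp mu') (l' := fun a => dexp mu (bump j a))); last exact: dmu.
  rewrite mulrCA; congr (_ * (_ * _)).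
  rewrite -signr_odd -[RHS]signr_odd !oddD !oddB ?leq_ord //=.
  by rewrite addbACA addbb addFb addbC.
- exact: index_enum_uniq.
- move=> p p' _ _ /(congr1 val) /= /eqP.
  by rewrite (dexp_inj nuR) // => /eqP/val_inj.
move=> r rn; rewrite /F big1 // => rho _.
rewrite negq_signed_constant0 ?mulr0 // psi_diag_out //.
apply: contra rn => /(mem_word _ nuR)[p pm [rE]].
apply/mapP; exists (Ordinal pm); first by rewrite mem_index_enum.
exact: val_inj.
Qed.

Lemma structure_constants_rcons0 m rho (nu' mu' : seq nat) : (0 < m < n)%N ->
  rho \in rect m (n - m) ->
  mu' \in rect m.+1 (n - m.+1) -> nu' \in rect m.+1 (n - m.+1) ->
  laurent_negq (C m.+1 (rcons rho 0%N) mu' nu') =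
  qpair y (zvar n m) (fun j : 'I_m.+1 => ecol L n (dexp nu' j))
     (fschur y m.+1 (rcons rho 0%N) * altdet y m.+1 (dexp mu')).
Proof.
move=> mn rhoR muR' nuR'; have mn' : (m < n)%N by case/andP: mn.
(* the parities of m.+1 and m.-1 agree, so z is the one of Gr(m; n) *)
have [inR|wide] := boolP (rcons rho 0%N \in rect m.+1 (n - m.+1)).
  apply: (structure_constants_negq mn' (hC mn') _ inR muR' nuR') => _.
  by case: m mn {mn' rhoR muR' nuR' inR} => // m _; rewrite /= negbK.
rewrite (qpair_rcons_wide y _ _ mn rhoR wide muR').
by have [_ ->] := hC mn'; [exact: (rmorph0 negq)|].
Qed.

Lemma vertical_formula m x : (0 < m < n)%N -> (x < n)%N ->
  lam \in rect m (n - m) -> mu \in rect m (n - m) ->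
  nu \in rect m (n - m) -> x.+1 \notin word mu ->
  C m lam mu nu =
  \sum_(r < n) \sum_(rho <- rect m (n - m) | vstrip lam rho)
     (-1) ^+ size (boxes lam rho) * Bcoef m lam rho x.+1 r *
     laurent_negq (signed_constant (C m.+1) (rcons rho 0%N)
       (psi_star_diag x.+1 mu) (psi_star_diag r.+1 nu)).
Proof.
move=> mn xn lamR muR nuR xmu; have /andP[m0 mn'] := mn.
have [mu' [p [pm muE muR' px dmu]]] := psi_star_diagE muR mn' (xn : 0 < x.+1 <= n)%N xmu.
have pm1 : (p < m.+1)%N by [].
rewrite (structure_constantsE (z := zvar n m) (ltnW mn') (hC (ltnW mn'))
           (fun _ => erefl) lamR muR nuR).
rewrite (eq_altdet y (l := dexp mu) (l' := fun a => dexp mu' (bump p a)));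
  last exact: dmu.
have dlt (i : 'I_m.+1) : (dexp mu' i < n)%N.
  by have := dexp_bound muR' (ltn_ord i); rewrite subnK.
have dx (i : 'I_m.+1) : (dexp mu' i == x) = (i == Ordinal pm1).
  by rewrite -[x]px (dexp_inj muR').
have E := qpair_extend_slot y (zvar n m) (fun j => ecol L n (dexp nu j))
  (fschur y m lam) dlt dx.
rewrite -[LHS](signrMK (m - p)) -E (vertical_recursion y _ _ _ _ lamR).
rewrite exchange_big mulr_sumr big_seq_cond [RHS]big_seq_cond.
apply: eq_bigr => rho /andP[rhoR _]; rewrite mulrA mulr_sumr; apply: eq_bigr => r _.
rewrite BcoefE; set B := (_ *m _ *m _) _ _; set P := qpair _ _ _ _.
suff -> : laurent_negq (signed_constant (C m.+1) (rcons rho 0%N)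
    (psi_star_diag x.+1 mu) (psi_star_diag r.+1 nu)) = (-1) ^+ (m - p) * P.
  exact: mulr_swap.
(* if r.+1 is already a letter of nu, the constant is zero by definition, and P
   is zero because a covector is repeated *)
have [rnu|rnu] := boolP (r.+1 \in word nu).
  rewrite negq_signed_constant0; last by rewrite psi_star_diag_in.
  have [j jm [rj]] := mem_word _ nuR rnu.
  have -> : P = 0.
    apply: (@qpair_repeated _ _ _ _ _ _ _ _ _ (widen (Ordinal jm)) ord_max
      (two_neq0 n) (rect_rcons0 rhoR)).
      by rewrite -val_eqE /= ltn_eqF.
    by rewrite /extend_slot /= jm ltnn rj.
  by rewrite mulr0.
have [nu' [p1 [p1m nuE nuR' p1r dnu]]] :=
  psi_star_diagE nuR mn' (ltn_ord r : 0 < r.+1 <= n)%N rnu.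
have p1m1 : (p1 < m.+1)%N by [].
rewrite (negq_signed_constant _ _ muE nuE) (structure_constants_rcons0 mn rhoR muR' nuR').
have vE : extend_slot (m := m) (fun j => ecol L n (dexp nu j)) (ecol L n r) =1
    extend_slot (m := m) (fun j => ecol L n (dexp nu' (bump (Ordinal p1m1) j)))
       (ecol L n (dexp nu' (Ordinal p1m1))).
  by move=> j; rewrite /extend_slot p1r; case: ltnP => // jm; rewrite dnu.
rewrite /P (@eq_qpair _ _ _ _ _ _ _ _ vE).
rewrite (@qpair_lift _ _ _ _ _ _ _ _ _ _ (rect_rcons0 rhoR)).
by rewrite addnC exprD -mulrA.
Qed.
End Recursion.
End Final.

Theorem corollary4p3 (n : nat) (hn : (2 <= n)%N)
    (C : nat -> seq nat -> seq nat -> seq nat -> coefring n)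
    (hC : forall m : nat, (m <= n)%N -> structure_constants m (C m))
    (k : nat) (hk : (1 <= k <= n - 1)%N) (lam mu nu : seq nat)
    (hlam : lam \in rect k (n - k)) (hmu : mu \in rect k (n - k))
    (hnu : nu \in rect k (n - k)) :
  (forall j : nat, (1 <= j <= k)%N ->
     let i := (part mu j.-1 + (k.+1 - j))%N in
     C k lam mu nu =
       \sum_(r < n) \sum_(rho <- rect k.-1 (n - k) | hstrip lam rho)
         Acoef k lam rho i r *
         laurent_negq (signed_constant (C k.-1) rho
                         (psi_diag i mu) (psi_diag r.+1 nu))) /\
  (forall i : nat, (1 <= i <= n)%N ->
     (forall j : nat, (1 <= j <= k)%N -> i <> (part mu j.-1 + (k.+1 - j))%N) ->
     C k lam mu nu =
       \sum_(r < n) \sum_(rho <- rect k (n - k) | vstrip lam rho)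
         (-1) ^+ size (boxes lam rho) * Bcoef k lam rho i r *
         laurent_negq (signed_constant (C k.+1) (rcons rho 0%N)
                         (psi_star_diag i mu) (psi_star_diag r.+1 nu))).
Proof.
have [smu _ _] := rectP _ _ _ hmu.
have dexpE j : (j < k)%N -> (part mu j + (k.+1 - j.+1) = (dexp mu j).+1)%N.
  by move=> jk; rewrite /dexp smu; lia.
split.
  case=> // j /= jk; rewrite (dexpE j) //.
  case: k hk hlam hmu hnu jk {smu dexpE} => [|m] // hk hlam hmu hnu jk.
  by apply: (horizontal_formula hC) => //; lia.
case=> // x xn hx; apply: (vertical_formula hC) => //; first by lia.
apply/negP => /(mem_word _ hmu)[j jk xE].
by apply: (hx j.+1) => //=; rewrite (dexpE j).
Qed.
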